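(* Let $\Gamma=(X,F,r)$ be a gambling house such that: - $(X,d)$ is a compact metric space, - $r:X\to[0,1]$ is continuous, and - $F$ is non expansive for the Kantorovich–Rubinstein distance: for all $x,x'\in X$ and $u\in F(x)$ there exists $u'\in F(x')$ with $d_{KR}(u,u')\le d(x,x')$. Then $\Gamma$ has a general uniform value $v^*$, given for every $x\in X$ by $$v^*(x)=\inf\Big\{w(\delta_x):\ w:\Delta(X)\to[0,1]\text{ affine and weak-* continuous, such that (1) and (2) hold}\Big\},$$ where the two conditions on $w$ are: - (1) $w(\delta_y)\ge\sup_{u\in F(y)}w(u)$ for all $y\in X$; - (2) $w(u)\ge r(u)$ for all $u\in R$.
   Context: **Gambling house.** A gambling house $\Gamma=(X,F,r)$ consists of: - a nonempty set $X$, - a correspondence $F:X\rightrightarrows Z:=\Delta_f(X)$ (finitely supported probabilities) with nonempty values, and - $r:X\to[0,1]$. The payoff $r$ is extended linearly (and, when $X$ is compact metric and $r$ continuous, to all Borel probabilities by $r(u)=\int r\,du$). The mixed extension of $F$ is $$\hat F(u)=\Big\{\sum_xu(x)f(x):\ f:X\to Z,\ f(x)\in\mathrm{conv}\,F(x)\ \forall x\Big\}\quad\text{for } u\in Z.$$ **Plays and values.** A (mixed) play at $x_0\in X$ is a sequence $(u_1,u_2,\dots)\in Z^{\infty}$ with $u_1\in\mathrm{conv}\,F(x_0)$ and $u_{t+1}\in\hat F(u_t)$ for all $t\ge1$. - An evaluation is $\theta=(\theta_t)_{t\ge1}\in\Delta(\mathbb N^* )$, with impatience $I(\theta)=\sum_{t\ge1}|\theta_{t+1}-\theta_t|$.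 - The $\theta$-payoff of a play $\sigma=(u_t)_t$ is $\gamma_\theta(\sigma)=\sum_t\theta_tr(u_t)$. - The $\theta$-value at $x_0$ is $v_\theta(x_0)=\sup_\sigma\gamma_\theta(\sigma)$ over mixed plays $\sigma$ at $x_0$. **General values.** $\Gamma$ has a general limit value $v^*$ if for every $\varepsilon>0$ there is $\alpha>0$ such that $I(\theta)\le\alpha$ implies $|v_\theta(x)-v^*(x)|\le\varepsilon$ for all $x\in X$. It has a general uniform value if moreover, for every $\varepsilon>0$, there exist $\alpha>0$ and for each $x$ a mixed play $\sigma(x)$ at $x$ such that $I(\theta)\le\alpha$ implies $\gamma_\theta(\sigma(x))\ge v^*(x)-\varepsilon$ for all $x$. **Invariant measures.** $d_{KR}$ is the Kantorovich–Rubinstein distance on $\Delta(X)$ (Borel probabilities with the weak-* topology). The set of invariant measures is $R=\{u\in\Delta(X):(u,u)\in\mathrm{cl}(\mathrm{Graph}\,\hat F)\}$, where the closure is taken in $\Delta(X)\times\Delta(X)$. *)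

(* Defs.v *)
From HB Require Import structures.
From mathcomp Require Import all_boot all_order all_algebra.
From mathcomp Require Import all_classical all_reals all_analysis.

Set Implicit Arguments.
Unset Strict Implicit.
Unset Printing Implicit Defensive.

Import Order.TTheory GRing.Theory Num.Theory.
Local Open Scope classical_set_scope.
Local Open Scope ring_scope.

Section GamblingHouse.
Context {R : realType} {X : pointedType}.

Section Metric.
Variable d : X -> X -> R.

Definition is_metric : Prop :=
  [/\ (forall x y, 0 <= d x y),
      (forall x y, d x y = 0 <-> x = y),
      (forall x y, d x y = d y x) &
      (forall x y z, d x z <= d x y + d y z)].

Definition dopen (A : set X) : Prop :=
  forall x, A x -> exists2 e : R, 0 < e & forall y, d x y < e -> A y.

Definition dcompact : Prop :=
  forall (I : Type) (U : I -> set X), (forall i, dopen (U i)) ->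
    (forall x, exists i, U i x) ->
    exists J : set I, finite_set J /\ forall x, exists2 i, J i & U i x.

Definition dcontinuous (f : X -> R) : Prop :=
  forall x (e : R), 0 < e -> exists2 δ : R, 0 < δ &
    forall y, d x y < δ -> `|f x - f y| < e.

Definition lip1 (f : X -> R) : Prop := forall x y, `|f x - f y| <= d x y.

Definition Xb := g_sigma_algebraType dopen.

Definition Delta := probability Xb R.

Definition integ (mu : Delta) (f : X -> R) : R := Rintegral mu setT f.

End Metric.

Definition supp (p : X -> R) : set X := [set x | p x != 0].

Definition is_fsprob (p : X -> R) : Prop :=
  [/\ (forall x, 0 <= p x), finite_set (supp p) & \sum_(x \in supp p) p x = 1].

Definition integ_fs (p : X -> R) (f : X -> R) : R :=
  \sum_(x \in supp p) p x * f x.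

Definition dKR_fs (d : X -> X -> R) (u v : X -> R) : R :=
  sup [set `|integ_fs u f - integ_fs v f| | f in lip1 d].

Definition conv (S : set (X -> R)) : set (X -> R) :=
  [set p | exists (n : nat) (lam : 'I_n -> R) (s : 'I_n -> X -> R),
     [/\ (forall i, S (s i) /\ 0 <= lam i), \sum_(i < n) lam i = 1 &
         p = fun y => \sum_(i < n) lam i * s i y]].

Definition Fhat (F : X -> set (X -> R)) (u : X -> R) : set (X -> R) :=
  [set q | exists f : X -> X -> R, (forall x, conv (F x) (f x)) /\
             q = fun y => \sum_(x \in supp u) u x * f x y].

Definition rbar (r : X -> R) (u : X -> R) : R := integ_fs u r.

(* mixed plays at x0 : s 0, s 1, ... stand for u_1, u_2, ... *)
Definition is_play (F : X -> set (X -> R)) (x0 : X) (s : nat -> X -> R) : Prop :=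
  conv (F x0) (s 0%N) /\ forall t, Fhat F (s t) (s t.+1).

(* evaluations theta, probabilities on the positive integers: th t stands for theta_(t+1) *)
Definition is_eval (th : nat -> R) : Prop :=
  (forall t, 0 <= th t) /\ (\sum_(t <oo) (th t)%:E = 1)%E.

Definition impatience (th : nat -> R) : \bar R :=
  (\sum_(t <oo) (`|th t.+1 - th t|)%:E)%E.

Definition payoff (r : X -> R) (th : nat -> R) (s : nat -> X -> R) : R :=
  fine (\sum_(t <oo) (th t * rbar r (s t))%:E)%E.

Definition vtheta (F : X -> set (X -> R)) (r : X -> R) (th : nat -> R) (x0 : X) : R :=
  sup [set payoff r th s | s in is_play F x0].

Definition has_general_limit_value (F : X -> set (X -> R)) (r : X -> R)
    (v : X -> R) : Prop :=
  forall e : R, 0 < e -> exists2 a : R, 0 < a &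
    forall th, is_eval th -> (impatience th <= a%:E)%E ->
      forall x, `|vtheta F r th x - v x| <= e.

Definition has_general_uniform_value (F : X -> set (X -> R)) (r : X -> R)
    (v : X -> R) : Prop :=
  has_general_limit_value F r v /\
  forall e : R, 0 < e -> exists2 a : R, 0 < a &
    exists sig : X -> nat -> X -> R, (forall x, is_play F x (sig x)) /\
      forall th, is_eval th -> (impatience th <= a%:E)%E ->
        forall x, v x - e <= payoff r th (sig x).

Section OnDelta.
Variable d : X -> X -> R.

Definition diracX (y : X) : Delta d := (\d_(y : Xb d) : probability (Xb d) R).

Definition represents (mu : Delta d) (u : X -> R) : Prop :=
  forall A : set (Xb d), measurable A ->
    mu A = (\sum_(x \in supp u `&` A) u x)%:E.

Definition is_affine (w : Delta d -> R) : Prop :=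
  forall (mu nu rho : Delta d) (l : R), 0 <= l <= 1 ->
    (forall A : set (Xb d), measurable A ->
       rho A = (l%:E * mu A + (1 - l)%:E * nu A)%E) ->
    w rho = l * w mu + (1 - l) * w nu.

(* continuity for the weak-* topology on Delta(X), i.e. the coarsest topology
   making every mu |-> \int f dmu (f continuous) continuous *)
Definition weak_star_continuous (w : Delta d -> R) : Prop :=
  forall (mu : Delta d) (e : R), 0 < e ->
    exists (n : nat) (fs : 'I_n -> X -> R) (δ : R),
      [/\ 0 < δ, (forall i, dcontinuous d (fs i)) &
          forall nu : Delta d,
            (forall i, `|integ nu (fs i) - integ mu (fs i)| < δ) ->
            `|w nu - w mu| < e].

(* invariant measures: (mu, mu) lies in the closure (in Delta(X) x Delta(X),
   product of weak-* topologies) of Graph \hat F *)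
Definition invariant (F : X -> set (X -> R)) (mu : Delta d) : Prop :=
  forall (n : nat) (fs gs : 'I_n -> X -> R) (δ : R), 0 < δ ->
    (forall i, dcontinuous d (fs i) /\ dcontinuous d (gs i)) ->
    exists (z z' : X -> R) (mz mz' : Delta d),
      [/\ is_fsprob z, Fhat F z z', represents mz z, represents mz' z' &
          forall i, `|integ mz (fs i) - integ mu (fs i)| < δ /\
                    `|integ mz' (gs i) - integ mu (gs i)| < δ].

Definition admissible_w (F : X -> set (X -> R)) (r : X -> R)
    (w : Delta d -> R) : Prop :=
  [/\ (forall mu, 0 <= w mu <= 1), is_affine w, weak_star_continuous w,
      (* (1) *) (forall y u, F y u -> forall mu : Delta d, represents mu u ->
                   w mu <= w (diracX y)) &
      (* (2) *) (forall mu, invariant F mu -> integ mu r <= w mu)].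

Definition vstar (F : X -> set (X -> R)) (r : X -> R) (x : X) : R :=
  inf [set w (diracX x) | w in admissible_w F r].

End OnDelta.

End GamblingHouse.

(* Main.v *)
(** Write [S_th] for the value of the problem with finitely many stage weights
    [th].  Nonexpansiveness makes the Bellman operator preserve Lipschitz
    constants, so the functions [S_th] are equicontinuous.  Any uniform limit [V]
    of [S_th], as the impatience of [th] tends to 0, is continuous, excessive,
    and satisfies [r <= V] on invariant measures (iterate the Bellman inequality
    along the closure of the graph), hence [mu |-> \int V dmu] is an admissible
    [w].  Conversely the occupation measures of patient plays accumulate, by the
    Riesz theorem, at invariant measures, so every admissible [w] dominates the
    payoffs up to [eps].  Therefore [V = v*].

    For a uniform play, fix a block length [N] and consider the weightings that
    are constant on blocks.  By a finite minmax argument, from any mixed state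
    some path has a good average over the next block and loses almost nothing of
    the values of finitely many block weightings; by equicontinuity this controls
    all of them.  Iterating with summable losses gives a play all of whose
    [N]-block averages are at least [v* - eps], and such a play is [eps]-optimal
    for every weighting of small impatience. *)

Require Import Defs.
From HB Require Import structures.
From mathcomp Require Import all_boot all_order all_algebra.
From mathcomp Require Import all_classical all_reals all_analysis.
From mathcomp Require Import measurable_realfun ring lra.
Import Order.TTheory GRing.Theory Num.Theory.
Import numFieldNormedType.Exports.
Local Open Scope classical_set_scope.
Local Open Scope ring_scope.

Set Implicit Arguments.
Unset Strict Implicit.
Unset Printing Implicit Defensive.

(** The uniform play must be chosen before the weights, so the value of no single weighting can
    guide it. Block weightings are used because their class is closed under putting a new block in
    front: when minmax proposes weights on the current block average and on finitely many
    continuation values, the optimum of the weighted criterion is at least the value of one more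
    block weighting, which the present state already guarantees. Their impatience is at most [2 / N]
    whatever the block masses, so one [N] brings all their values close to [v*]. An evaluation of
    impatience much smaller than [1 / N] is almost constant on each block, which is why good block
    averages suffice. Limits of value functions and of occupation measures are taken along a free
    ultrafilter on the integers: all bounded sequences converge along it at once, and a bad sequence
    found by contradiction is used as it stands, without passing to subsequences. *)

Local Notation conv := Defs.conv.

(** * Finitely supported probabilities, mixtures and convex hulls *)

Section FiniteSupport.
Context {R : realType} {X : pointedType}.
Implicit Types (u v p q : X -> R) (f g : X -> R) (S : set (X -> R)).

Definition carries (s : seq X) u := uniq s /\ forall x, u x != 0 -> x \in s.

Lemma integ_fsE s u f : carries s u -> integ_fs u f = \sum_(x <- s) u x * f x.
Proof.
move=> [us cs]; apply: fsbig_fwiden => //.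
by move=> x /= [_ /negP]; rewrite negbK => /eqP ->; rewrite mul0r.
Qed.

Lemma finite_supp_carries u : finite_set (supp u) -> exists s, carries s u.
Proof.
move=> fu; exists (finmap.enum_fset (fset_set (supp u))); split; first exact: finmap.fset_uniq.
by move=> x ux; rewrite in_fset_set// inE.
Qed.

Lemma carries_finite_supp s u : carries s u -> finite_set (supp u).
Proof.
move=> [us cs]; apply: (@sub_finite_set _ _ [set` s]); first by move=> x ux /=; exact: cs.
exact: finite_seq.
Qed.

Lemma family_carries (I : finType) (u : I -> X -> R) :
  (forall i, finite_set (supp (u i))) -> exists s, forall i, carries s (u i).
Proof.
move=> fu; have /choice[s cs] : forall i, exists s, carries s (u i).
  by move=> i; exact: finite_supp_carries.
exists (undup (flatten [seq s i | i <- enum I])) => i; split; first exact: undup_uniq.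
move=> x uix; rewrite mem_undup; apply/flattenP; exists (s i).
  by apply/mapP; exists i => //; rewrite mem_enum.
by case: (cs i) => _; exact.
Qed.

Lemma fsprob_sumE u : \sum_(x \in supp u) u x = integ_fs u (cst 1).
Proof. by apply: eq_fsbigr => x _; rewrite mulr1. Qed.

Lemma fsprob_carries u : is_fsprob u -> exists s, carries s u.
Proof. by case=> _ fu _; exact: finite_supp_carries. Qed.

Lemma integ_fsD u f g : is_fsprob u ->
  integ_fs u (fun x => f x + g x) = integ_fs u f + integ_fs u g.
Proof.
move=> /fsprob_carries[s cs]; rewrite !(integ_fsE _ cs) -big_split/=.
by apply: eq_bigr => x _; rewrite mulrDr.
Qed.

Lemma integ_fsZ u c f : is_fsprob u ->
  integ_fs u (fun x => c * f x) = c * integ_fs u f.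
Proof.
move=> /fsprob_carries[s cs]; rewrite !(integ_fsE _ cs) mulr_sumr.
by apply: eq_bigr => x _; rewrite mulrCA.
Qed.

Lemma integ_fs_cst u c : is_fsprob u -> integ_fs u (fun=> c) = c.
Proof.
move=> pu; rewrite -[c in LHS]mulr1 (@integ_fsZ u c (cst 1) pu) -fsprob_sumE.
by case: pu => _ _ ->; rewrite mulr1.
Qed.

Lemma integ_fsB u f g : is_fsprob u ->
  integ_fs u (fun x => f x - g x) = integ_fs u f - integ_fs u g.
Proof.
move=> pu; rewrite integ_fsD// -[in RHS]mulN1r -integ_fsZ//.
by congr (_ + integ_fs u _); apply/funext => x; rewrite mulN1r.
Qed.

Lemma ler_integ_fs u f g : is_fsprob u -> (forall x, f x <= g x) ->
  integ_fs u f <= integ_fs u g.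
Proof.
move=> pu fg; have [s cs] := fsprob_carries pu; rewrite !(integ_fsE _ cs).
by apply: ler_sum => x _; apply: ler_wpM2l => //; case: pu.
Qed.

Lemma integ_fs_dist u f g e : is_fsprob u -> (forall x, `|f x - g x| <= e) ->
  `|integ_fs u f - integ_fs u g| <= e.
Proof.
move=> pu fg; rewrite -integ_fsB// ler_norml; apply/andP; split.
  rewrite -(integ_fs_cst (- e) pu); apply: ler_integ_fs => // x.
  by have := fg x; rewrite ler_norml => /andP[].
rewrite -[leRHS](integ_fs_cst e pu); apply: ler_integ_fs => // x.
by have := fg x; rewrite ler_norml => /andP[].
Qed.

Lemma integ_fs_bound u f a b : is_fsprob u -> (forall x, a <= f x <= b) ->
  a <= integ_fs u f <= b.
Proof.
move=> pu ab; rewrite -{1}(integ_fs_cst a pu) -[X in _ && (_ <= X)](integ_fs_cst b pu).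
by apply/andP; split; apply: ler_integ_fs => // x; have /andP[] := ab x.
Qed.

Section Mixture.
Context {I : finType}.
Variables (lam : I -> R) (w : I -> X -> R).

Definition mixt : X -> R := fun y => \sum_i lam i * w i y.

Lemma mixt_carries s : (forall i, carries s (w i)) -> uniq s -> carries s mixt.
Proof.
move=> cs us; split => // x; apply: contraR => xs.
rewrite /mixt big1// => i _; apply/eqP; rewrite mulf_eq0; apply/orP; right.
by apply: contraNT xs; case: (cs i) => _; exact.
Qed.

Lemma integ_fs_mixt f : (forall i, finite_set (supp (w i))) ->
  integ_fs mixt f = \sum_i lam i * integ_fs (w i) f.
Proof.
move=> fw; have [s cs0] := family_carries fw.
have cs : forall i, carries (undup s) (w i).
  by move=> i; have [? c] := cs0 i; split; [exact: undup_uniq|move=> x /c; rewrite mem_undup].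
rewrite (integ_fsE _ (mixt_carries cs (undup_uniq s))).
under [RHS]eq_bigr do rewrite (integ_fsE _ (cs _)) mulr_sumr.
rewrite exchange_big/=; apply: eq_bigr => x _; rewrite mulr_suml.
by apply: eq_bigr => i _; rewrite mulrA.
Qed.

Lemma mixt_fsprob : (forall i, 0 <= lam i) -> \sum_i lam i = 1 ->
  (forall i, is_fsprob (w i)) -> is_fsprob mixt.
Proof.
move=> l0 l1 pw; have fw i : finite_set (supp (w i)) by case: (pw i).
split.
- by move=> x; apply: sumr_ge0 => i _; apply: mulr_ge0 => //; case: (pw i).
- have [s cs0] := family_carries fw.
  apply: (@carries_finite_supp (undup s)); apply: mixt_carries (undup_uniq s) => i.
  by have [? c] := cs0 i; split; [exact: undup_uniq|move=> x /c; rewrite mem_undup].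
- rewrite fsprob_sumE integ_fs_mixt// -[RHS]l1; apply: eq_bigr => i _.
  by rewrite (integ_fs_cst 1 (pw i)) mulr1.
Qed.

End Mixture.

(** Listing the support turns the composition of [u] with a kernel into a mixture indexed by an
    ordinal, to which the lemmas on [mixt] apply. *)
Lemma bind_mixt u (k : X -> X -> R) : finite_set (supp u) ->
  exists (n : nat) (x : 'I_n -> X),
    [/\ (fun y => \sum_(x \in supp u) u x * k x y) =
          mixt (fun i => u (x i)) (fun i => k (x i)),
        (forall f, integ_fs u f = \sum_i u (x i) * f (x i)) &
        injective x].
Proof.
move=> /finite_supp_carries[s cs]; exists (size s), (tnth (in_tuple s)); split.
- apply/funext => y; rewrite -[LHS]/(integ_fs u (k ^~ y)) (integ_fsE _ cs).
  by rewrite /mixt big_tnth.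
- by move=> f; rewrite (integ_fsE _ cs) big_tnth.
- by case: cs => us _; exact/tuple_uniqP.
Qed.

Lemma conv_fin S (I : finType) (lam : I -> R) (w : I -> X -> R) :
  (forall i, S (w i)) -> (forall i, 0 <= lam i) -> \sum_i lam i = 1 ->
  conv S (mixt lam w).
Proof.
move=> Sw l0 l1; exists #|I|, (fun i => lam (enum_val i)), (fun i => w (enum_val i)).
split; [by move=> i; split| |].
  rewrite -l1 (reindex (fun i : 'I_#|I| => enum_val i))//=.
  by exists enum_rank => i _; [exact: enum_valK|exact: enum_rankK].
apply/funext => y; rewrite /mixt (reindex (fun i : 'I_#|I| => enum_val i))//=.
by exists enum_rank => i _; [exact: enum_valK|exact: enum_rankK].
Qed.

Lemma sub_conv S : S `<=` conv S.
Proof.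
move=> p Sp; have -> : p = mixt (fun _ : 'I_1 => 1) (fun=> p).
  by apply/funext => y; rewrite /mixt big_ord1 mul1r.
by apply: conv_fin => //; rewrite big_ord1.
Qed.

Lemma conv_mixt S (I : finType) (lam : I -> R) (w : I -> X -> R) :
  (forall i, conv S (w i)) -> (forall i, 0 <= lam i) -> \sum_i lam i = 1 ->
  conv S (mixt lam w).
Proof.
move=> cv l0 l1.
have [n [mu [s cw]]] : exists (n : I -> nat) (mu : forall i, 'I_(n i) -> R)
    (s : forall i, 'I_(n i) -> X -> R), forall i,
    [/\ forall j, S (s i j) /\ 0 <= mu i j, \sum_j mu i j = 1 &
        w i = fun y => \sum_j mu i j * s i j y].
  pose cv1 i := projT2 (cid (cv i)); pose cv2 i := projT2 (cid (cv1 i)).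
  by exists (fun i => projT1 (cid (cv i))), (fun i => projT1 (cid (cv1 i))),
    (fun i => projT1 (cid (cv2 i))) => i; exact: projT2 (cid (cv2 i)).
(* A mixture of mixtures is one mixture over dependent pairs, with product weights. *)
pose J := {i : I & 'I_(n i)}.
have -> : mixt lam w = mixt (fun j : J => lam (tag j) * mu (tag j) (tagged j))
                            (fun j : J => s (tag j) (tagged j)).
  apply/funext => y; rewrite /mixt.
  under eq_bigr => i _.
    have [_ _ ->] := cw i; rewrite mulr_sumr.
    under eq_bigr do rewrite mulrA.
    over.
  by rewrite sig_big_dep//=.
apply: conv_fin.
- by move=> j; have [/(_ (tagged j))[]] := cw (tag j).
- move=> j; apply: mulr_ge0 => //.
  by have [/(_ (tagged j))[]] := cw (tag j).
- transitivity (\sum_i \sum_(j < n i) lam i * mu i j); first by rewrite sig_big_dep.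
  rewrite -[RHS]l1; apply: eq_bigr => i _; rewrite -mulr_sumr.
  by have [_ -> _] := cw i; rewrite mulr1.
Qed.

Lemma conv_fsprob S : (forall p, S p -> is_fsprob p) ->
  forall p, conv S p -> is_fsprob p.
Proof.
move=> Sp p [n [lam [s [Ss l1 ->]]]].
by apply: (@mixt_fsprob _ lam s) => // i; [case: (Ss i)|apply: Sp; case: (Ss i)].
Qed.

Lemma conv_le S f c : (forall p, S p -> is_fsprob p) ->
  (forall p, S p -> integ_fs p f <= c) -> forall p, conv S p -> integ_fs p f <= c.
Proof.
move=> Sp Sc p [n [lam [s [Ss l1 ->]]]].
rewrite (@integ_fs_mixt _ lam s); last by move=> i; case: (Sp _ (Ss i).1).
rewrite -[c]mul1r -l1 mulr_suml; apply: ler_sum => i _.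
by apply: ler_wpM2l; [case: (Ss i)|apply: Sc; case: (Ss i)].
Qed.

End FiniteSupport.

(** * Transitions and plays of a gambling house *)

Section Plays.
Context {R : realType} {X : pointedType}.
Variable F : X -> set (X -> R).
Hypothesis F0 : forall x, exists u, F x u.
Hypothesis Fp : forall x u, F x u -> is_fsprob u.
Implicit Types (u v p q : X -> R) (f g : X -> R).

Definition dirac_fs (x : X) : X -> R := fun y => (y == x)%:R.

Lemma dirac_fs_carries x : carries [:: x] (dirac_fs x).
Proof.
split=> // y; rewrite /dirac_fs mem_seq1; case: (y == x) => //.
by rewrite eqxx.
Qed.

Lemma integ_dirac_fs x f : integ_fs (dirac_fs x) f = f x.
Proof. by rewrite (integ_fsE _ (dirac_fs_carries x)) big_seq1 /dirac_fs eqxx mul1r. Qed.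

Lemma dirac_fsprob x : is_fsprob (dirac_fs x).
Proof.
split; [by move=> y; rewrite ler0n|exact: carries_finite_supp (dirac_fs_carries x)|].
by rewrite fsprob_sumE integ_dirac_fs.
Qed.

Lemma Fhat_dirac x : Fhat F (dirac_fs x) = conv (F x).
Proof.
apply/seteqP; split => [q [f [cf ->]]|q cq].
  suff -> : (fun y => \sum_(z \in supp (dirac_fs x)) dirac_fs x z * f z y) = f x by [].
  by apply/funext => y; exact: (integ_dirac_fs x (f ^~ y)).
have /choice[g Fg] := F0.
exists (fun z => if z == x then q else g z); split.
  by move=> z; case: eqP => [->//|_]; exact: sub_conv.
apply/funext => y; rewrite -[RHS]/(integ_fs (dirac_fs x) (fun z => (if z == x then q else g z) y)).
by rewrite integ_dirac_fs eqxx.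
Qed.

Lemma Fhat_integE u q : is_fsprob u -> Fhat F u q ->
  is_fsprob q /\ exists2 k : X -> X -> R, (forall x, conv (F x) (k x)) &
    forall f, integ_fs q f = integ_fs u (fun x => integ_fs (k x) f).
Proof.
move=> pu [k [ck ->]]; have pk x : is_fsprob (k x) by exact: conv_fsprob (@Fp x) _ (ck x).
have [n [x [-> Eu _]]] := bind_mixt k (let: And3 _ h _ := pu in h).
split.
  apply: mixt_fsprob => // [i|]; first by case: pu.
  by rewrite -(integ_fs_cst 1 pu) Eu; apply: eq_bigr => i _; rewrite mulr1.
exists k => // f; rewrite integ_fs_mixt; last by move=> i; case: (pk (x i)).
by rewrite Eu.
Qed.

Lemma Fhat_fsprob u q : is_fsprob u -> Fhat F u q -> is_fsprob q.
Proof. by move=> pu /Fhat_integE[]. Qed.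

Lemma Fhat_le u q f g : is_fsprob u -> Fhat F u q ->
  (forall x p, F x p -> integ_fs p f <= g x) -> integ_fs q f <= integ_fs u g.
Proof.
move=> pu /(Fhat_integE pu)[pq [k ck ->]] fg.
by apply: ler_integ_fs => // x; apply: conv_le (@Fp x) _ _ (ck x) => p /fg.
Qed.

Lemma Fhat_near_opt u f g e : is_fsprob u -> 0 < e ->
  (forall x, exists2 p, F x p & g x - e <= integ_fs p f) ->
  exists2 q, Fhat F u q & integ_fs u g - e <= integ_fs q f.
Proof.
move=> pu e0 h.
have /choice[k /all_and2[Fk kf]] : forall x, exists p, F x p /\ g x - e <= integ_fs p f.
  by move=> x; have [p] := h x; exists p.
have [n [x [E Eu _]]] := bind_mixt k (let: And3 _ h _ := pu in h).
exists (fun y => \sum_(x \in supp u) u x * k x y).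
  by exists k; split => // z; exact: sub_conv.
rewrite E integ_fs_mixt; last by move=> i; case: (Fp (Fk (x i))).
rewrite -(Eu (fun x => integ_fs (k x) f)) -(integ_fs_cst e pu) -integ_fsB//.
exact: ler_integ_fs.
Qed.

Lemma Fhat_ex u : exists q, Fhat F u q.
Proof.
have /choice[g Fg] := F0.
exists (fun y => \sum_(x \in supp u) u x * g x y), g; split => // x.
exact: sub_conv.
Qed.

(** At a state charged by the mixture, average the kernels [k i] with the conditional probability of
    [i] given that state. This convexity of the graph serves both the occupation measures and the
    mixing of paths. *)
Lemma Fhat_mixt (I : finType) (lam : I -> R) (w v : I -> X -> R) :
  (forall i, 0 <= lam i) -> (forall i, is_fsprob (w i)) ->
  (forall i, Fhat F (w i) (v i)) -> Fhat F (mixt lam w) (mixt lam v).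
Proof.
move=> l0 pw /choice[k kv].
have /choice[g Fg] := F0.
have mixt0 x : mixt lam w x = 0 -> forall i, lam i * w i x = 0.
  move=> /eqP; rewrite psumr_eq0 => [/allP h i|i _]; last first.
    by apply: mulr_ge0 => //; case: (pw i).
  by apply/eqP; apply: h; rewrite mem_index_enum.
pose k' x := if mixt lam w x == 0 then g x else
  mixt (fun i => lam i * w i x / mixt lam w x) (fun i => k i x).
exists k'; split.
  move=> x; rewrite /k'; case: eqP => [_|/eqP m0]; first exact: sub_conv.
  apply: conv_mixt.
  - by move=> i; have [h _] := kv i.
  - move=> i; apply: divr_ge0; last apply: sumr_ge0 => j _.
      by apply: mulr_ge0 => //; case: (pw i).
    by apply: mulr_ge0 => //; case: (pw j).
  - by rewrite -mulr_suml divff.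
have fw i : finite_set (supp (w i)) by case: (pw i).
have [s cs] := family_carries fw.
apply/funext => y.
transitivity (\sum_i lam i * integ_fs (w i) (fun x => k i x y)).
  by apply: eq_bigr => i _; have [_ ->] := kv i.
rewrite -[RHS]/(integ_fs (mixt lam w) (k' ^~ y)).
have cs' i : carries (undup s) (w i).
  by have [? c] := cs i; split; [exact: undup_uniq|move=> x /c; rewrite mem_undup].
rewrite (integ_fsE _ (mixt_carries lam cs' (undup_uniq s))).
under eq_bigr do rewrite (integ_fsE _ (cs' _)) mulr_sumr.
rewrite exchange_big/=; apply: eq_bigr => x _.
rewrite /k'; case: eqP => [m0|/eqP m0].
  by rewrite m0 mul0r big1// => i _; rewrite mulrA mixt0// mul0r.
rewrite {2}/mixt mulr_sumr; apply: eq_bigr => i _.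
by field.
Qed.

Lemma play_fsprob x s : is_play F x s -> forall t, is_fsprob (s t).
Proof.
move=> [s0 sS]; elim=> [|t IH]; first exact: conv_fsprob (@Fp x) _ s0.
exact: Fhat_fsprob IH (sS t).
Qed.

End Plays.

(** * Compact metric spaces: continuity, finite nets, total boundedness *)

Section CompactMetric.
Context {R : realType} {X : pointedType}.
Variable d : X -> X -> R.
Hypothesis dm : is_metric d.
Hypothesis dc : dcompact d.
Implicit Types (f g h : X -> R).

Lemma dxx x : d x x = 0. Proof. by case: dm => _ /(_ x x)[_ ->]. Qed.
Lemma dC x y : d x y = d y x. Proof. by case: dm. Qed.
Lemma dge0 x y : 0 <= d x y. Proof. by case: dm. Qed.
Lemma dtri x y z : d x z <= d x y + d y z. Proof. by case: dm. Qed.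

Lemma dcontinuous_comp2 (C : R) f g h : 0 <= C ->
  (forall x y, `|h x - h y| <= C * (`|f x - f y| + `|g x - g y|)) ->
  dcontinuous d f -> dcontinuous d g -> dcontinuous d h.
Proof.
move=> C0 hfg cf cg x e e0.
have C1 : 0 < C + 1 by lra.
have e1 : 0 < e / (2 * (C + 1)) by apply: divr_gt0 => //; lra.
have [a a0 ha] := cf x _ e1; have [b b0 hb] := cg x _ e1.
exists (Num.min a b); first by rewrite lt_min a0.
move=> y; rewrite lt_min => /andP[/ha xa /hb xb].
apply: le_lt_trans (hfg x y) _.
have -> : e = (C + 1) * (e / (2 * (C + 1)) + e / (2 * (C + 1))) by field; lra.
by nra.
Qed.

Lemma dcontinuous_cst c : dcontinuous d (fun=> c).
Proof. by move=> x e e0; exists 1 => // y _; rewrite subrr normr0. Qed.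

Lemma dcontinuous_lip L f : (forall x y, `|f x - f y| <= L * d x y) -> dcontinuous d f.
Proof.
move=> Lf x e e0; exists (e / (`|L| + 1)); first by rewrite divr_gt0// ltr_wpDl.
move=> y xy; apply: le_lt_trans (Lf x y) _.
apply: (@le_lt_trans _ _ ((`|L| + 1) * d x y)).
  by rewrite ler_wpM2r ?dge0//; have := ler_norm L; lra.
by rewrite mulrC -ltr_pdivlMr// ltr_wpDl.
Qed.

Lemma dcontinuousD f g : dcontinuous d f -> dcontinuous d g ->
  dcontinuous d (fun x => f x + g x).
Proof.
apply: (@dcontinuous_comp2 1) => // x y; rewrite mul1r opprD addrACA.
exact: ler_normD.
Qed.

Lemma dcontinuousZ c f : dcontinuous d f -> dcontinuous d (fun x => c * f x).
Proof.
move=> cf; apply: (@dcontinuous_comp2 `|c| f f) => // x y.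
by rewrite -mulrBr normrM ler_wpM2l// lerDl.
Qed.

Lemma dcontinuousN f : dcontinuous d f -> dcontinuous d (fun x => - f x).
Proof.
move=> cf; have := dcontinuousZ (-1) cf.
by under eq_fun do rewrite mulN1r.
Qed.

Lemma dcontinuousB f g : dcontinuous d f -> dcontinuous d g ->
  dcontinuous d (fun x => f x - g x).
Proof. by move=> cf cg; apply: dcontinuousD => //; exact: dcontinuousN. Qed.

Lemma max_dist (a b a' b' : R) :
  `|Num.max a b - Num.max a' b'| <= 1 * (`|a - a'| + `|b - b'|).
Proof.
rewrite mul1r /Num.max; case: ltP => ?; case: ltP => ?;
  case: (ger0P (_ - _)) => ?; case: (ger0P (_ - _)) => ?;
  try (case: (ger0P (_ - _)) => ?); lra.
Qed.

Lemma dcontinuous_max f g : dcontinuous d f -> dcontinuous d g ->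
  dcontinuous d (fun x => Num.max (f x) (g x)).
Proof. by apply: (@dcontinuous_comp2 1) => // x y; exact: max_dist. Qed.

Lemma dcontinuous_min f g : dcontinuous d f -> dcontinuous d g ->
  dcontinuous d (fun x => Num.min (f x) (g x)).
Proof.
move=> cf cg; have := dcontinuousN (dcontinuous_max (dcontinuousN cf) (dcontinuousN cg)).
congr dcontinuous; apply/funext => x.
by rewrite oppr_max !opprK.
Qed.

Lemma finite_net (delta : X -> R) : (forall x, 0 < delta x) ->
  exists s : seq X, forall x, exists2 y, y \in s & d y x < delta y.
Proof.
move=> d0; have [||J [fJ cJ]] := dc (U := fun y => [set x | d y x < delta y]).
- move=> y x /= yx; exists (delta y - d y x) => [|z /= xz]; first by rewrite subr_gt0.
  by have := dtri y x z; lra.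
- by move=> x; exists x; rewrite /= dxx.
exists (finmap.enum_fset (fset_set J)) => x; have [y Jy yx] := cJ x; exists y => //.
by rewrite in_fset_set// inE.
Qed.

Lemma seq_min_gt0 (T : eqType) (s : seq T) (a : T -> R) : (forall x, 0 < a x) ->
  exists2 m : R, 0 < m & forall x, x \in s -> m <= a x.
Proof.
move=> a0; elim: s => [|x s [m m0 hm]]; first by exists 1.
exists (Num.min m (a x)); first by rewrite lt_min m0 a0.
move=> y; rewrite inE => /orP[/eqP ->|/hm my]; first by rewrite ge_min lexx orbT.
by rewrite ge_min my.
Qed.

Lemma dcontinuous_bounded f : dcontinuous d f -> exists2 B, 0 <= B & forall x, `|f x| <= B.
Proof.
move=> cf; have /choice[a ha] : forall x, exists a : R, 0 < a /\
    forall y, d x y < a -> `|f x - f y| < 1.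
  by move=> x; have [a a0 h] := cf x _ (@ltr01 R); exists a.
have [s hs] := finite_net (fun x => (ha x).1).
exists (\sum_(y <- s) `|f y| + 1); first by rewrite addr_ge0// sumr_ge0.
move=> x; have [y ys yx] := hs x; have /ltW h := (ha y).2 _ yx.
have -> : f x = f y - (f y - f x) by ring.
apply: le_trans (ler_normB _ _) _; apply: lerD => //.
by rewrite (big_rem y)//= lerDl sumr_ge0.
Qed.

Lemma unif_continuous f e : dcontinuous d f -> 0 < e ->
  exists2 a, 0 < a & forall x y, d x y < a -> `|f x - f y| < e.
Proof.
move=> cf e0; have e2 : 0 < e / 2 by rewrite divr_gt0.
have /choice[a ha] : forall x, exists a : R, 0 < a /\
    forall y, d x y < a -> `|f x - f y| < e / 2.
  by move=> x; have [a a0 h] := cf x _ e2; exists a.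
(* Radii are halved so that, for [x] in the half ball around [z], every [y] within the least half
   radius of [x] stays in the full ball around [z]. *)
have a20 x : 0 < a x / 2 by rewrite divr_gt0// (ha x).1.
have [s hs] := finite_net a20; have [m m0 hm] := seq_min_gt0 s a20.
exists m => // x y xy; have [z zs zx] := hs x.
have h1 : `|f z - f x| < e / 2 by apply: (ha z).2; have := (ha z).1; lra.
have h2 : `|f z - f y| < e / 2.
  by apply: (ha z).2; have := hm _ zs; have := dtri z x y; lra.
have -> : f x - f y = (f z - f y) - (f z - f x) by ring.
by apply: le_lt_trans (ler_normB _ _) _; lra.
Qed.

(** The approximation is the inf-convolution of [f] with the cone of slope [a^-1]. From distance [a]
    on, the cone is at least 1, the width of the range of [f], so only points where [f] varies by
    less than [e] matter. *)
Lemma lip_approx f e : (forall x, 0 <= f x <= 1) -> dcontinuous d f -> 0 < e ->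
  exists2 L, 0 <= L & exists2 h : X -> R, (forall x y, `|h x - h y| <= L * d x y) &
    forall x, 0 <= h x <= 1 /\ `|f x - h x| <= e.
Proof.
move=> f01 cf e0; have [a a0 ha] := unif_continuous cf e0.
have fle x y : f x <= f y + e + a^-1 * d x y.
  have [xy|xy] := ltP (d x y) a.
    have := ha _ _ xy; rewrite ltr_norml => /andP[_].
    have : 0 <= a^-1 * d x y by rewrite mulr_ge0 ?invr_ge0 ?dge0// ltW.
    by lra.
  have : 1 <= a^-1 * d x y by rewrite mulrC ler_pdivlMr// mul1r.
  by have := f01 x; have := f01 y; lra.
have L0 : 0 <= a^-1 by rewrite invr_ge0 ltW.
pose A x := [set f y + a^-1 * d x y | y in setT].
have Alb x : lbound (A x) (f x - e).
  by move=> _ [y _ <-]; have := fle x y; lra.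
have Ai x : has_inf (A x).
  by split; [exists (f x + a^-1 * d x x), x|exists (f x - e)].
exists a^-1 => //; exists (fun x => inf (A x)).
  suff hle x y : inf (A x) <= inf (A y) + a^-1 * d x y.
    by move=> x y; rewrite ler_norml; have := hle x y; have := hle y x; rewrite dC; lra.
  rewrite -lerBlDr; apply: lb_le_inf; first exact: (Ai y).1.
  move=> _ [z _ <-]; rewrite lerBlDr; apply: le_trans (_ : _ <= f z + a^-1 * d x z) _.
    by apply: ge_inf; [exact: (Ai x).2|exists z].
  by rewrite -addrA lerD2l -mulrDr ler_wpM2l// addrC dtri.
move=> x; have h1 : inf (A x) <= f x.
  by apply: ge_inf; [exact: (Ai x).2|exists x => //; rewrite dxx mulr0 addr0].
have h2 : f x - e <= inf (A x) by apply: lb_le_inf; [exact: (Ai x).1|exact: Alb].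
split; last by rewrite ger0_norm; lra.
apply/andP; split; last by have /andP[_] := f01 x; lra.
apply: lb_le_inf; first exact: (Ai x).1.
move=> _ [y _ <-]; apply: addr_ge0; first by have /andP[] := f01 y.
by rewrite mulr_ge0// dge0.
Qed.

Definition equicont (I : Type) (h : I -> X -> R) := forall e, 0 < e ->
  exists2 a, 0 < a & forall i x y, d x y < a -> `|h i x - h i y| <= e.

(** Arzela-Ascoli in finitary form: record the values on a finite net, rounded to the mesh [e / 4].
    Two functions with the same record differ by at most [e / 4] on the net, and by two more
    oscillations [e / 4] elsewhere. *)
Lemma equicont_totally_bounded I (h : I -> X -> R) e :
  equicont h -> (forall i x, 0 <= h i x <= 1) -> 0 < e ->
  exists (m : nat) (j : 'I_m -> I), forall i, exists k, forall x,
    `|h i x - h (j k) x| <= e.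
Proof.
move=> eh h01 e0; have e4 : 0 < e / 4 by rewrite divr_gt0.
have [a a0 ha] := eh _ e4; have [s hs] := finite_net (fun=> a0).
pose M := (Num.truncn (1 / (e / 4))).+1.
pose code i : {ffun 'I_(size s) -> 'I_M} :=
  [ffun k => inord (Num.truncn (h i (tnth (in_tuple s) k) / (e / 4)))].
have codeP i i' : code i = code i' -> forall x, `|h i x - h i' x| <= e.
  move=> cii x; have [y ys yx] := hs x.
  have [k ky] : exists k, y = tnth (in_tuple s) k by apply/tnthP.
  move: cii => /ffunP/(_ k); rewrite !ffunE -ky => /(congr1 val) /=.
  have tr l : (Num.truncn (h l y / (e / 4)) < M)%N.
    rewrite ltnS; apply: le_truncn; rewrite ler_pM2r ?invr_gt0//.
    by have /andP[] := h01 l y.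
  rewrite !inordK// => E.
  have hq l : 0 <= h l y / (e / 4) by rewrite divr_ge0 ?(ltW e4)//; have /andP[] := h01 l y.
  have /andP[l1 u1] := truncn_itv (hq i); have /andP[l2 u2] := truncn_itv (hq i').
  rewrite E in l1 u1; move: l1 u1 l2 u2; set T := (Num.truncn _) => l1 u1 l2 u2.
  rewrite ler_pdivlMr// in l1; rewrite ler_pdivlMr// in l2.
  rewrite ltr_pdivrMr// in u1; rewrite ltr_pdivrMr// in u2.
  rewrite -natr1 mulrDl mul1r in u1 u2.
  have := ha i _ _ yx; have := ha i' _ _ yx; rewrite !ler_norml => /andP[? ?] /andP[? ?].
  by apply/andP; split; lra.
have [[i0]|nI] := pselect (exists i : I, True); last first.
  exists 0%N; have ek (k : 'I_0) : I by case: k.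
  by exists ek => i; exfalso; apply: nI; exists i.
move=> _.
pose rep (c : {ffun 'I_(size s) -> 'I_M}) : I :=
  if pselect (exists i, code i = c) is left E then projT1 (cid E) else i0.
have repP i : code (rep (code i)) = code i.
  rewrite /rep; case: pselect => [E|]; last by case; exists i.
  exact: projT2 (cid E).
exists #|{ffun 'I_(size s) -> 'I_M}|, (fun k => rep (enum_val k)) => i.
exists (enum_rank (code i)); rewrite enum_rankK.
by apply: codeP; rewrite repP.
Qed.

End CompactMetric.

(** * Limits along ultrafilters *)

Section Ultralimits.
Context {R : realType}.

Lemma ultra_cvg (U : set_system nat) (a : nat -> R) (B : R) : UltraFilter U ->
  (forall n, `|a n| <= B) -> cvg (a n @[n --> U]).
Proof.
move=> UU aB; have := @segment_compact R (- B) B.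
move=> /(_ (a n @[n --> U]) _)[|l [_ cl]].
  by rewrite /fmap/=; apply: filterE => n; have := aB n; rewrite ler_norml /= in_itv.
apply/cvg_ex; exists l => A nA.
have [//|UA] := in_ultra_setVsetC (a @^-1` A) UU.
have [x [/=]] := cl (~` A) A UA nA.
by [].
Qed.

(** Since [U] refines the filter at infinity, whatever holds for all large [n] holds along [U]. *)
Lemma free_ultrafilter : exists2 U : set_system nat, UltraFilter U & \oo `<=` U.
Proof. by have [U [UU oU]] := ultraFilterLemma (T := nat) eventually_filter; exists U. Qed.

End Ultralimits.

(** * Integrals of continuous functions; measures with finite support *)

Section IntegralContinuous.
Context {R : realType} {X : pointedType}.
Variable d : X -> X -> R.
Hypothesis dm : is_metric d.
Hypothesis dc : dcompact d.
Implicit Types (f g h : X -> R) (mu nu : Delta d).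

Lemma dopen_measurable (A : set (Xb d)) : dopen d A -> measurable A.
Proof. by move=> oA; apply: sub_sigma_algebra. Qed.

Lemma dopen_gt f a : dcontinuous d f -> dopen d [set x | a < f x].
Proof.
move=> cf x /= xa; have [|e e0 he] := cf x (f x - a); first by rewrite subr_gt0.
by exists e => // y /he; rewrite ltr_norml => /andP[_] /=; lra.
Qed.

Lemma dcontinuous_measurable f : dcontinuous d f ->
  measurable_fun [set: Xb d] (f : Xb d -> R).
Proof.
move=> cf; apply: (measurability _ (RGenOInfty.measurableE R)).
move=> _ [_ [a ->] <-]; rewrite setTI; apply: dopen_measurable.
have -> : f @^-1` `]a, +oo[%classic = [set x | a < f x].
  by apply/seteqP; split => x /=; rewrite in_itv/= andbT.
exact: dopen_gt.
Qed.

Lemma Delta_setT mu : (mu : {measure set (Xb d) -> \bar R}) [set: Xb d] = 1%E.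
Proof. exact: (@probability_setT _ (Xb d) R mu). Qed.

Lemma dcontinuous_integrable mu f : dcontinuous d f ->
  mu.-integrable [set: Xb d] (EFin \o (f : Xb d -> R)).
Proof.
move=> cf; apply: measurable_bounded_integrable => //.
- by rewrite Delta_setT ltry.
- exact: dcontinuous_measurable.
- have [B B0 fB] := dcontinuous_bounded dm dc cf.
  exists B; split; first exact: num_real.
  by move=> y By x _; apply: le_trans (fB x) (ltW By).
Qed.

Lemma integ_cst mu c : integ mu (fun=> c) = c.
Proof. by rewrite /integ Rintegral_cst// Delta_setT mulr1. Qed.

Lemma integD mu f g : dcontinuous d f -> dcontinuous d g ->
  integ mu (fun x => f x + g x) = integ mu f + integ mu g.
Proof. by move=> cf cg; apply: RintegralD => //; exact: dcontinuous_integrable. Qed.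

Lemma integZ mu c f : dcontinuous d f ->
  integ mu (fun x => c * f x) = c * integ mu f.
Proof. by move=> cf; apply: RintegralZl => //; exact: dcontinuous_integrable. Qed.

Lemma ler_integ mu f g : dcontinuous d f -> dcontinuous d g ->
  (forall x, f x <= g x) -> integ mu f <= integ mu g.
Proof. by move=> cf cg fg; apply: le_Rintegral => //; exact: dcontinuous_integrable. Qed.

Lemma integ_bound mu f a b : dcontinuous d f -> (forall x, a <= f x <= b) ->
  a <= integ mu f <= b.
Proof.
move=> cf ab; rewrite -{1}(integ_cst mu a) -[X in _ && (_ <= X)](integ_cst mu b).
by apply/andP; split; apply: ler_integ => //; try exact: dcontinuous_cst;
  move=> x; have /andP[] := ab x.
Qed.

Lemma integ_dist mu f g e : dcontinuous d f -> dcontinuous d g ->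
  (forall x, `|f x - g x| <= e) -> `|integ mu f - integ mu g| <= e.
Proof.
move=> cf cg fg.
have h (f' g' : X -> R) : dcontinuous d f' -> dcontinuous d g' ->
    (forall x, `|f' x - g' x| <= e) -> integ mu f' <= integ mu g' + e.
  move=> cf' cg' fg'; rewrite -[e in leRHS](integ_cst mu) -integD//; last exact: dcontinuous_cst.
  apply: ler_integ => //; first by apply: dcontinuousD => //; exact: dcontinuous_cst.
  by move=> x; have := fg' x; rewrite ler_norml => /andP[_]; lra.
rewrite ler_norml; have := h _ _ cf cg fg.
have : integ mu g <= integ mu f + e by apply: h => // x; rewrite distrC.
by lra.
Qed.

Lemma integ_diracX y f : dcontinuous d f -> integ (diracX d y) f = f y.
Proof.
move=> cf; rewrite /integ /Rintegral.
have -> : (\int[diracX d y]_x (f x)%:E = (f y)%:E)%E.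
  have mf : measurable_fun [set: Xb d] (EFin \o (f : Xb d -> R)).
    by apply/measurable_EFinP; exact: dcontinuous_measurable.
  by rewrite (integral_dirac _ measurableT mf) diracT mul1e.
by [].
Qed.

(* Shifting by a constant reduces identities between integrals to nonnegative
   functions. *)
Lemma integ_ge0_ext (mu : Delta d) (L : (X -> R) -> R) :
  (forall f c, dcontinuous d f -> L (fun x => f x + c) = L f + c) ->
  (forall f, dcontinuous d f -> (forall x, 0 <= f x) -> integ mu f = L f) ->
  forall f, dcontinuous d f -> integ mu f = L f.
Proof.
move=> LD L0 f cf; have [B B0 fB] := dcontinuous_bounded dm dc cf.
apply: (@addIr _ B); rewrite -LD// -L0.
- by rewrite integD// ?integ_cst//; exact: dcontinuous_cst.
- by apply: dcontinuousD => //; exact: dcontinuous_cst.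
- by move=> x; have := fB x; rewrite ler_norml; lra.
Qed.

Section FiniteMeasure.
Variables (s : seq X) (u : X -> R).
Hypothesis cs : carries s u.
Hypothesis pu : is_fsprob u.

Definition fsweight (i : nat) : {nonneg R} :=
  NngNum (let: And3 h _ _ := pu in h (nth point s i)).

Definition fsmeasure : set (Xb d) -> \bar R :=
  msum (fun i => mscale (fsweight i) (\d_(nth point s i : Xb d))) (size s).

HB.instance Definition _ := Measure.on fsmeasure.

Lemma fsmeasureE (A : set (Xb d)) :
  fsmeasure A = (\sum_(x <- s) u x * (x \in A)%:R)%:E.
Proof.
rewrite /fsmeasure /msum -sumEFin (big_nth point) big_mkord.
by apply: eq_bigr => i _; rewrite /= /mscale/= diracE.
Qed.

Lemma fsmeasureT : fsmeasure setT = 1%E.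
Proof.
rewrite fsmeasureE; congr EFin; rewrite -[RHS](integ_fs_cst 1 pu) (integ_fsE _ cs).
by apply: eq_bigr => x _; rewrite in_setT.
Qed.

HB.instance Definition _ := Measure_isProbability.Build _ _ _ fsmeasure fsmeasureT.

Definition fsproba : Delta d := fsmeasure.

Lemma fsproba_represents : represents fsproba u.
Proof.
move=> A mA; rewrite /fsproba /= fsmeasureE; congr EFin.
case: cs => us cu.
rewrite fsbig_mkcondr.
rewrite (fsbig_fwiden s) //.
- apply: eq_bigr => x _; rewrite /patch; case: ifPn => _; first by rewrite mulr1.
  by rewrite mulr0.
- move=> x /= [_ /negP]; rewrite negbK => /eqP ux0.
  by rewrite /patch ux0; case: ifPn.
Qed.

Lemma integ_fsproba f : dcontinuous d f -> integ fsproba f = integ_fs u f.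
Proof.
apply: integ_ge0_ext => [g c _|g cg g0].
  by rewrite integ_fsD// integ_fs_cst.
have mg : measurable_fun [set: Xb d] (EFin \o (g : Xb d -> R)).
  by apply/measurable_EFinP; exact: dcontinuous_measurable.
rewrite /integ /Rintegral ge0_integral_measure_sum//=; last first.
  by move=> x _; rewrite lee_fin.
under eq_bigr => i _.
  rewrite ge0_integral_mscale//; last by move=> x _; rewrite lee_fin.
  rewrite integral_dirac// diracT mul1e -EFinM.
  over.
by rewrite /= sumEFin /= (integ_fsE _ cs) (big_nth point) big_mkord.
Qed.

End FiniteMeasure.

Lemma fsprob_represented u : is_fsprob u -> exists mu : Delta d, represents mu u.
Proof.
move=> pu; have [s cs] := fsprob_carries pu.
by exists (fsproba cs pu); exact: fsproba_represents.
Qed.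

Lemma integ_represents mu u f : is_fsprob u -> represents mu u -> dcontinuous d f ->
  integ mu f = integ_fs u f.
Proof.
move=> pu ru cf; have [s cs] := fsprob_carries pu.
rewrite -(integ_fsproba cs pu cf) /integ /Rintegral; congr fine.
apply: eq_measure_integral => A mA _.
by apply: (etrans (ru A mA)); apply/esym; exact: (fsproba_represents cs pu mA).
Qed.

Lemma integ_is_affine f : dcontinuous d f -> is_affine (fun mu : Delta d => integ mu f).
Proof.
move=> cf mu nu rho l /andP[l0 l1] rhoE; move: f cf.
apply: integ_ge0_ext => [f c cf|f cf f0].
  by rewrite !integD ?integ_cst//; try exact: dcontinuous_cst; ring.
have l10 : 0 <= 1 - l by lra.
have mf : measurable_fun [set: Xb d] (EFin \o (f : Xb d -> R)).
  by apply/measurable_EFinP; exact: dcontinuous_measurable.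
have f0' (x : Xb d) : [set: Xb d] x -> (0%R <= (EFin \o f) x)%E by rewrite lee_fin.
rewrite {1}/integ /Rintegral.
rewrite (eq_measure_integral
  (measure_add (mscale (NngNum l0) mu) (mscale (NngNum l10) nu))); last first.
  by move=> A mA _; apply: (etrans (rhoE A mA)); apply/esym; exact: measure_addE.
rewrite ge0_integral_measure_add// !ge0_integral_mscale//=.
have fin (m : Delta d) : (\int[m]_x (f x)%:E)%E \is a fin_num.
  exact: integrable_fin_num (dcontinuous_integrable m cf).
by rewrite fineD ?fin_numM// !fineM.
Qed.

Lemma integ_weak_star_continuous f : dcontinuous d f ->
  weak_star_continuous (fun mu : Delta d => integ mu f).
Proof.
by move=> cf mu e e0; exists 1%N, (fun=> f), e; split => // nu /(_ ord0).
Qed.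

End IntegralContinuous.

(** * Riesz representation by the Caratheodory construction *)

Section Riesz.
Context {R : realType} {X : pointedType}.
Variable d : X -> X -> R.
Hypothesis dm : is_metric d.
Hypothesis dc : dcompact d.
Implicit Types (f g h : X -> R) (A U V : set X).

Lemma dopen_bigcup (U : nat -> set X) : (forall i, dopen d (U i)) ->
  dopen d (\bigcup_i U i).
Proof.
move=> oU x [i _ /oU[e e0 he]]; exists e => // y /he Uy; by exists i.
Qed.

Lemma dopenI U V : dopen d U -> dopen d V -> dopen d (U `&` V).
Proof.
move=> oU oV x [/oU[a a0 ha] /oV[b b0 hb]]; exists (Num.min a b).
  by rewrite lt_min a0.
by move=> y; rewrite lt_min => /andP[/ha ? /hb ?].
Qed.

Lemma dopenT : dopen d setT. Proof. by move=> x _; exists 1. Qed.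

Lemma dopen0 : dopen d set0. Proof. by move=> x. Qed.

(** The distance to the complement of [U], capped at 1; the extra element 1 also keeps the infimum
    over a nonempty set when [U] is the whole space. *)
Definition tent U (x : X) : R := inf ([set d x y | y in ~` U] `|` [set 1]).

Lemma tent_has_inf U x : has_inf ([set d x y | y in ~` U] `|` [set 1]).
Proof.
split; first by exists 1; right.
by exists 0 => _ [[y _ <-]|->//]; exact: dge0.
Qed.

Lemma tent_ge0 U x : 0 <= tent U x.
Proof.
apply: lb_le_inf; first exact: (tent_has_inf U x).1.
by move=> _ [[y _ <-]|->//]; exact: dge0.
Qed.

Lemma tent_out U x : ~ U x -> tent U x = 0.
Proof.
move=> nUx; apply/eqP; rewrite eq_le tent_ge0 andbT.
apply: ge_inf; first exact: (tent_has_inf U x).2.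
by left; exists x => //; rewrite dxx.
Qed.

Lemma tent_gt0 U x : dopen d U -> U x -> 0 < tent U x.
Proof.
move=> oU Ux; have [e e0 he] := oU _ Ux.
apply: (@lt_le_trans _ _ (Num.min e 1)); first by rewrite lt_min e0/=.
apply: lb_le_inf; first exact: (tent_has_inf U x).1.
move=> _ [[y nUy <-]|->]; last by rewrite ge_min lexx orbT.
rewrite ge_min; apply/orP; left; rewrite leNgt; apply/negP => /he.
exact: nUy.
Qed.

Lemma dcontinuous_tent U : dcontinuous d (tent U).
Proof.
apply: (@dcontinuous_lip _ _ _ dm 1) => x y; rewrite mul1r.
suff h a b : tent U a <= tent U b + d a b.
  by have := h x y; have := h y x; rewrite (dC dm y x) ler_norml; lra.
rewrite -lerBlDr; apply: lb_le_inf; first exact: (tent_has_inf U b).1.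
move=> _ [[z nUz <-]|->].
  rewrite lerBlDr; apply: le_trans (_ : _ <= d a z) _.
    by apply: ge_inf; [exact: (tent_has_inf U a).2|left; exists z].
  by rewrite addrC; exact: dtri.
have : tent U a <= 1 by apply: ge_inf; [exact: (tent_has_inf U a).2|right].
by have := dge0 dm a b; lra.
Qed.

Variable L : (X -> R) -> R.
Hypothesis LD : forall f g, dcontinuous d f -> dcontinuous d g ->
  L (fun x => f x + g x) = L f + L g.
Hypothesis LZ : forall c f, dcontinuous d f -> L (fun x => c * f x) = c * L f.
Hypothesis Lge0 : forall f, dcontinuous d f -> (forall x, 0 <= f x) -> 0 <= L f.
Hypothesis L1 : L (fun=> 1) = 1.

Lemma Lcst c : L (fun=> c) = c.
Proof.
have E := LZ c (dcontinuous_cst d 1); rewrite L1 mulr1 in E; rewrite -[RHS]E.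
by congr L; apply/funext => x; rewrite mulr1.
Qed.

Lemma Lle f g : dcontinuous d f -> dcontinuous d g -> (forall x, f x <= g x) -> L f <= L g.
Proof.
move=> cf cg fg; have cb : dcontinuous d (fun x => g x - f x) by exact: dcontinuousB.
have -> : g = fun x => f x + (g x - f x) by apply/funext => x; ring.
by rewrite LD// lerDl; apply: Lge0 => // x; rewrite subr_ge0.
Qed.

Lemma dcontinuous_sum n (f : nat -> X -> R) : (forall i, dcontinuous d (f i)) ->
  dcontinuous d (fun x => \sum_(i < n) f i x).
Proof.
move=> cf; elim: n => [|n IH].
  by under eq_fun do rewrite big_ord0; exact: dcontinuous_cst.
by under eq_fun do rewrite big_ord_recr/=; exact: dcontinuousD.
Qed.

Lemma Lsum n (f : nat -> X -> R) : (forall i, dcontinuous d (f i)) ->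
  L (fun x => \sum_(i < n) f i x) = \sum_(i < n) L (f i).
Proof.
move=> cf; elim: n => [|n IH].
  by under eq_fun do rewrite big_ord0; rewrite big_ord0 Lcst.
under eq_fun do rewrite big_ord_recr/=.
by rewrite LD// ?IH ?big_ord_recr//; exact: dcontinuous_sum.
Qed.

Definition below U f := [/\ dcontinuous d f, forall x, 0 <= f x <= 1 &
  forall x, ~ U x -> f x = 0].

Definition cap U : R := sup [set L f | f in below U].

Lemma cap_has_sup U : has_sup [set L f | f in below U].
Proof.
split.
  by exists (L (fun=> 0)), (fun=> 0) => //; split=> [|x|//];
    [exact: dcontinuous_cst|rewrite lexx ler01].
exists 1 => _ [f [cf f01 _] <-]; rewrite -L1; apply: Lle => //.
  exact: dcontinuous_cst.
by move=> x; have /andP[] := f01 x.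
Qed.

Lemma cap_ub U f : below U f -> L f <= cap U.
Proof. by move=> bf; apply: ub_le_sup; [exact: (cap_has_sup U).2|exists f]. Qed.

Lemma cap_le U c : (forall f, below U f -> L f <= c) -> cap U <= c.
Proof.
move=> h; apply: ge_sup; first exact: (cap_has_sup U).1.
by move=> _ [f bf <-]; exact: h.
Qed.

Lemma cap_ge0 U : 0 <= cap U.
Proof.
by rewrite -(Lcst 0); apply: cap_ub; split=> [|x|//]; [exact: dcontinuous_cst|rewrite lexx ler01].
Qed.

Lemma cap_mono U V : U `<=` V -> cap U <= cap V.
Proof.
move=> UV; apply: cap_le => f [cf f01 f0]; apply: cap_ub; split => // x nVx.
by apply: f0 => /UV.
Qed.

Lemma capT : cap setT = 1.
Proof.
apply/eqP; rewrite eq_le; apply/andP; split.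
  apply: cap_le => f [cf f01 _]; rewrite -L1; apply: Lle => //.
    exact: dcontinuous_cst.
  by move=> x; have /andP[] := f01 x.
by rewrite -{1}L1; apply: cap_ub; split=> [|x|x []//]; [exact: dcontinuous_cst|rewrite lexx ler01].
Qed.

Lemma cap0 : cap set0 = 0.
Proof.
apply/eqP; rewrite eq_le cap_ge0 andbT; apply: cap_le => f [cf _ f0].
by rewrite -(Lcst 0); apply: Lle => //; [exact: dcontinuous_cst|move=> x; rewrite f0].
Qed.

(** The sets [V n] are open, increasing and cover [X], so by compactness some [V N] is all of [X].
    There [f] is at most [e] plus the sum over [i < N] of the minima of [f] and [N * tent (U i)],
    each of which vanishes off [U i]. *)
Lemma cap_subadd (U : nat -> set X) f e : (forall i, dopen d (U i)) ->
  below (\bigcup_i U i) f -> 0 < e -> exists n, L f <= e + \sum_(i < n) cap (U i).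
Proof.
move=> oU [cf f01 f0] e0.
pose V (n : nat) : set X := [set x | f x < e] `|`
  [set x | exists2 i, (i < n)%N & 1 < n%:R * tent (U i) x].
have oV n : dopen d (V n).
  move=> x [/= fx|/= [i ni ix]].
    have := @dopen_gt _ _ d (fun x => - f x) (- e) (dcontinuousN cf) x.
    case=> /=; first by rewrite ltrN2.
    by move=> a a0 ha; exists a => // y /ha; rewrite ltrN2 => fy; left.
  have [a a0 ha] := dopen_gt (dcontinuousZ n%:R (dcontinuous_tent (U i))) ix.
  by exists a => // y /ha iy; right; exists i.
have Vmono m n : (m <= n)%N -> V m `<=` V n.
  move=> mn x [fx|[i im ix]]; first by left.
  right; exists i; first exact: leq_trans mn.
  apply: lt_le_trans ix _; apply: ler_wpM2r; first exact: tent_ge0.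
  by rewrite ler_nat.
have Vcov x : exists n, V n x.
  have [fx|fx] := ltP (f x) e; first by exists 0%N; left.
  have [i _ Ui] : (\bigcup_i U i) x.
    by apply: contrapT => /f0 f0x; rewrite f0x in fx; lra.
  have b0 := tent_gt0 (oU i) Ui.
  exists (maxn i.+1 (Num.truncn (tent (U i) x)^-1).+1); right; exists i.
    by rewrite leq_max ltnSn.
  rewrite -ltr_pdivrMr// mul1r; apply: lt_le_trans (truncnS_gt _) _.
  by rewrite ler_nat leq_maxr.
have [J [fJ cJ]] := dc oV Vcov.
have [N hN] : exists N, forall n, J n -> (n <= N)%N.
  exists (\max_(n <- finmap.enum_fset (fset_set J)) n)%N => n Jn.
  by apply: leq_bigmax_seq => //; rewrite in_fset_set// inE.
exists N; pose g i x := Num.min (f x) (N%:R * tent (U i) x).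
have cg i : dcontinuous d (g i).
  by apply: dcontinuous_min => //; apply: dcontinuousZ; exact: dcontinuous_tent.
have g0 i x : 0 <= g i x.
  by rewrite le_min mulr_ge0 ?tent_ge0// andbT; have /andP[] := f01 x.
have bg i : below (U i) (g i).
  split => // x; first rewrite g0/=.
    by apply: le_trans (_ : f x <= 1); [rewrite ge_min lexx|have /andP[] := f01 x].
  by move=> nU; rewrite /g tent_out// mulr0; apply/min_idPr; have /andP[] := f01 x.
apply: (@le_trans _ _ (L (fun x => e + \sum_(i < N) g i x))).
  apply: Lle => //.
    by apply: dcontinuousD; [exact: dcontinuous_cst|exact: dcontinuous_sum].
  move=> x; have [n /hN nN /(Vmono _ _ nN)] := cJ x.
  have s0 : 0 <= \sum_(i < N) g i x by apply: sumr_ge0.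
  move=> [/= fx|[i iN ix]]; first by lra.
  rewrite (bigD1 (Ordinal iN))//=.
  have -> : g i x = f x.
    by apply/min_idPl; apply: le_trans (ltW ix); have /andP[] := f01 x.
  have : 0 <= \sum_(j < N | j != Ordinal iN) g j x by apply: sumr_ge0.
  by lra.
rewrite LD; [|exact: dcontinuous_cst|exact: dcontinuous_sum].
rewrite Lcst lerD2l Lsum//; apply: ler_sum => i _; exact: cap_ub.
Qed.

Definition outer (A : set X) : R := inf [set cap U | U in [set U | dopen d U /\ A `<=` U]].

Lemma outer_has_inf A : has_inf [set cap U | U in [set U | dopen d U /\ A `<=` U]].
Proof.
split; first by exists (cap setT), setT => //; split => //; exact: dopenT.
by exists 0 => _ [U _ <-]; exact: cap_ge0.
Qed.

Lemma outer_le A U : dopen d U -> A `<=` U -> outer A <= cap U.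
Proof. by move=> oU AU; apply: ge_inf; [exact: (outer_has_inf A).2|exists U]. Qed.

Lemma le_outer A c : (forall U, dopen d U -> A `<=` U -> c <= cap U) -> c <= outer A.
Proof.
move=> h; apply: lb_le_inf; first exact: (outer_has_inf A).1.
by move=> _ [U [oU AU] <-]; exact: h.
Qed.

Lemma outer_open U : dopen d U -> outer U = cap U.
Proof.
move=> oU; apply/eqP; rewrite eq_le outer_le//=.
by apply: le_outer => V _; exact: cap_mono.
Qed.

Lemma outer_adherent A e : 0 < e ->
  exists U, [/\ dopen d U, A `<=` U & cap U < outer A + e].
Proof.
move=> e0; have [_ [U [oU AU] <-] h] := inf_adherent e0 (outer_has_inf A).
by exists U.
Qed.

Definition eouter (A : set X) : \bar R := (outer A)%:E.

Lemma eouter0 : eouter set0 = 0%E.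
Proof. by rewrite /eouter outer_open ?cap0//; exact: dopen0. Qed.

Lemma eouter_ge0 A : (0 <= eouter A)%E.
Proof. by rewrite lee_fin; apply: le_outer => U _ _; exact: cap_ge0. Qed.

Lemma le_eouter : {homo eouter : A B / A `<=` B >-> (A <= B)%E}.
Proof.
move=> A B AB; rewrite lee_fin; apply: le_outer => U oU BU.
by apply: outer_le => //; exact: subset_trans BU.
Qed.

Lemma eouter_sigma_subadditive : sigma_subadditive eouter.
Proof.
move=> A; apply/lee_addgt0Pr => e e0.
(* One half of [e] pays for the open enlargements, in geometric shares; the other half pays for
   [cap_subadd]. *)
have e2 : 0 < e / 2 by rewrite divr_gt0.
have eV n : 0 < e / 2 / (2 ^ n.+1)%:R by rewrite divr_gt0// ltr0n expn_gt0.
have /choice[U hU] : forall i, exists U, [/\ dopen d U, A i `<=` U &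
    cap U < outer (A i) + e / 2 / (2 ^ i.+1)%:R].
  by move=> i; exact: outer_adherent.
have oU i : dopen d (U i) by case: (hU i).
have AU : \bigcup_i A i `<=` \bigcup_i U i.
  by move=> x [i _ Ax]; exists i => //; case: (hU i) => _ + _; exact.
apply: (@le_trans _ _ (cap (\bigcup_i U i))%:E).
  by rewrite lee_fin; apply: outer_le => //; exact: dopen_bigcup.
rewrite [e]splitr EFinD addeA.
apply: (@le_trans _ _ (\sum_(i <oo) (eouter (A i) + (e / 2 / (2 ^ i.+1)%:R)%:E)
    + (e / 2)%:E)%E); last first.
  apply: leeD2r.
  apply: (@epsilon_trick R (fun i => eouter (A i)) (e / 2) xpredT) => [i|].
    exact: eouter_ge0.
  exact: ltW.
apply: (@le_trans _ _ (\sum_(i <oo) (cap (U i))%:E + (e / 2)%:E)%E); last first.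
  apply: leeD2r; apply: lee_nneseries => i; first by rewrite lee_fin cap_ge0.
  by move=> _; rewrite -EFinD lee_fin ltW//; case: (hU i).
set S := (\sum_(i <oo) _)%E.
have part n : ((\sum_(i < n) cap (U i))%:E <= S)%E.
  rewrite -sumEFin -(big_mkord xpredT (fun i => (cap (U i))%:E)).
  by apply: nneseries_lim_ge => k _ _; rewrite lee_fin cap_ge0.
have [Sfin|] := boolP (S \is a fin_num); last first.
  rewrite fin_numEn => /orP[|] /eqP SE.
    by have := part 0%N; rewrite SE leeNy_eq.
  by rewrite SE addye// leey.
rewrite -(fineK Sfin) -EFinD lee_fin; apply: cap_le => f bf.
have [n hn] := cap_subadd oU bf e2; apply: le_trans hn _.
by rewrite addrC lerD2r -lee_fin fineK.
Qed.

HB.instance Definition _ := isOuterMeasure.Build R X eouter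
  eouter0 eouter_ge0 le_eouter eouter_sigma_subadditive.

(* If [f] lives on [W `&` U] and [g] on the part of [W] where [f < e], then
   [(f - e)^+ + g] lives on [W]. *)
Lemma dopen_caratheodory U : dopen d U -> caratheodory_measurable eouter U.
Proof.
move=> oU; apply: (@le_caratheodory_measurable R X eouter) => A.
rewrite -EFinD lee_fin; apply: le_outer => W oW AW.
apply/ler_addgt0Pr => e e0; have e2 : 0 < e / 2 by rewrite divr_gt0.
have [_ [f [cf f01 f0] <-] hf] := sup_adherent e2 (cap_has_sup (W `&` U)).
rewrite -/(cap _) in hf.
pose W' := W `&` [set x | f x < e / 2].
have oW' : dopen d W'.
  apply: dopenI => // x /= fx.
  have := @dopen_gt _ _ d (fun x => - f x) (- (e / 2)) (dcontinuousN cf) x.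
  case=> /=; first by rewrite ltrN2.
  by move=> a a0 ha; exists a => // y /ha; rewrite ltrN2.
have AW' : A `&` ~` U `<=` W'.
  by move=> x [/AW Wx nUx]; split => //=; rewrite f0// => -[].
apply: le_trans (_ : _ <= cap (W `&` U) + cap W') _.
  by apply: lerD; apply: outer_le => //; [exact: dopenI|move=> x [/AW]].
rewrite -lerBrDl; apply: cap_le => g [cg g01 g0].
suff : L (fun x => Num.max (f x - e / 2) 0 + g x) <= cap W.
  rewrite LD//; last first.
    apply: dcontinuous_max; last exact: dcontinuous_cst.
    by apply: dcontinuousB => //; exact: dcontinuous_cst.
  have : L (fun x => f x + (- (e / 2))) <= L (fun x => Num.max (f x - e / 2) 0).
    apply: Lle => [||x]; last by rewrite le_max lexx.
      by apply: dcontinuousD => //; exact: dcontinuous_cst.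
    apply: dcontinuous_max; last exact: dcontinuous_cst.
    by apply: dcontinuousB => //; exact: dcontinuous_cst.
  rewrite LD// ?Lcst; last exact: dcontinuous_cst.
  by lra.
apply: cap_ub; split.
- apply: dcontinuousD => //; apply: dcontinuous_max; last exact: dcontinuous_cst.
  by apply: dcontinuousB => //; exact: dcontinuous_cst.
- move=> x; have := f01 x; have := g01 x.
  have [fe|fe] := ltP (f x) (e / 2).
    have -> : Num.max (f x - e / 2) 0 = 0 by apply/max_idPr; lra.
    by rewrite add0r.
  rewrite (g0 x); last by move=> [_] /=; lra.
  by rewrite addr0 ge_max le_max lexx orbT/=; lra.
- move=> x nWx; rewrite g0; last by case.
  rewrite f0; last by case.
  by rewrite addr0; apply/max_idPr; lra.
Qed.

Lemma measurable_caratheodory (A : set (Xb d)) : measurable A ->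
  caratheodory_measurable eouter A.
Proof.
move: A; apply: smallest_sub; last exact: dopen_caratheodory.
exact: (@sigma_algebra_measurable _ (caratheodory_type eouter)).
Qed.

Definition riesz_measure : set (Xb d) -> \bar R := eouter.

Lemma riesz_sigma_additive : semi_sigma_additive riesz_measure.
Proof.
move=> A mA tA mUA.
apply: (@caratheodory_measure_sigma_additive R X eouter) => //.
- by move=> i; exact: measurable_caratheodory.
- exact: measurable_caratheodory.
Qed.

HB.instance Definition _ := isMeasure.Build _ _ _ riesz_measure
  eouter0 eouter_ge0 riesz_sigma_additive.

Lemma riesz_measureT : riesz_measure setT = 1%E.
Proof. by rewrite /riesz_measure /eouter outer_open ?capT//; exact: dopenT. Qed.

HB.instance Definition _ := Measure_isProbability.Build _ _ _ riesz_measure riesz_measureT.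

Definition riesz_proba : Delta d := riesz_measure.

(** [f] is at most the indicator of the open set where it is positive, and the measure of that set
    is its [cap]. *)
Lemma integ_le_cap f : dcontinuous d f -> (forall x, 0 <= f x <= 1) ->
  integ riesz_proba f <= cap [set x | 0 < f x].
Proof.
move=> cf f01; have oU := dopen_gt (a := 0) cf; rewrite -outer_open//.
rewrite -lee_fin /integ /Rintegral fineK; last first.
  exact: integrable_fin_num (dcontinuous_integrable dm dc riesz_proba cf).
have mU : measurable ([set x | 0 < f x] : set (Xb d)) by exact: dopen_measurable.
rewrite -[leRHS]/(riesz_measure ([set x | 0 < f x] : set (Xb d))) -[X in riesz_measure X]setIT.
rewrite -integral_indic//; apply: ge0_le_integral => //.
- by move=> x _; rewrite lee_fin; have /andP[] := f01 x.
- by apply/measurable_EFinP; exact: dcontinuous_measurable.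
- by apply/measurable_EFinP; exact: measurable_indic.
- move=> x _; rewrite lee_fin indicE; have /andP[fx0 fx1] := f01 x.
  case: (boolP (x \in _)) => //; rewrite notin_setE /= => /negP; rewrite -leNgt.
  by [].
Qed.

(* Layer cake: [n f] is the sum of the slices [f_k], and [f_(k+1) > 0] forces
   [f_k = 1]. *)
Lemma integ_le_L f : dcontinuous d f -> (forall x, 0 <= f x <= 1) ->
  integ riesz_proba f <= L f.
Proof.
move=> cf f01; apply/ler_addgt0Pr => e e0.
pose n := (Num.truncn e^-1).+1.
have n0 : 0 < n%:R :> R by rewrite ltr0n.
have en : n%:R^-1 < e.
  by rewrite invf_plt// ?posrE//; exact: truncnS_gt.
pose fk k x := Num.min (n%:R * f x) k.+1%:R - Num.min (n%:R * f x) k%:R.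
have nf0 x : 0 <= n%:R * f x by rewrite mulr_ge0//; have /andP[] := f01 x.
have cfk k : dcontinuous d (fk k).
  by apply: dcontinuousB; apply: dcontinuous_min => //;
    try exact: dcontinuous_cst; exact: dcontinuousZ.
have fk01 k x : 0 <= fk k x <= 1.
  rewrite /fk -natr1 /Num.min; case: ltP => ?; case: ltP => ?; lra.
have sumfk x : \sum_(k < n) fk k x = n%:R * f x.
  rewrite -(big_mkord xpredT (fun k => fk k x)) /fk.
  rewrite telescope_sumr//.
  have -> : Num.min (n%:R * f x) 0%:R = 0 by apply/min_idPr.
  rewrite subr0; apply/min_idPl; rewrite -[leRHS]mulr1 ler_pM2l//.
  by have /andP[] := f01 x.
have step k : integ riesz_proba (fk k.+1) <= L (fk k).
  apply: le_trans (integ_le_cap (cfk _) (fk01 _)) _.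
  apply: cap_le => h [ch h01 h0]; apply: Lle => // x.
  have [x0|x0] := ltP 0 (fk k.+1 x); last first.
    by rewrite h0/=; [have /andP[] := fk01 k x|move=> ?; lra].
  have -> : fk k x = 1.
    have [hk|hk] := leP (n%:R * f x) k.+1%:R.
      move: x0; rewrite /fk (min_idPl hk) (min_idPl _) ?subrr ?ltxx//.
      by apply: le_trans hk _; rewrite ler_nat.
    have hk' : k%:R <= n%:R * f x by apply: le_trans (ltW hk); rewrite ler_nat.
    by rewrite /fk (min_idPr (ltW hk)) (min_idPr hk') -natr1; ring.
  by have /andP[] := h01 x.
have I0 : integ riesz_proba (fk 0%N) <= 1.
  by have /andP[] := integ_bound dm dc riesz_proba (cfk 0%N) (fk01 0%N).
have isum m : integ riesz_proba (fun x => \sum_(k < m) fk k x) =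
    \sum_(k < m) integ riesz_proba (fk k).
  elim: m => [|m IH].
    by under eq_fun do rewrite big_ord0; rewrite big_ord0 integ_cst.
  under eq_fun do rewrite big_ord_recr/=.
  by rewrite integD// ?IH ?big_ord_recr//; exact: dcontinuous_sum.
(* Matching slice [k + 1] with slice [k] leaves the first slice alone. It costs at most 1, that is
   [1 / n < e] after division by [n]. *)
have main : n%:R * integ riesz_proba f <= 1 + n%:R * L f.
  rewrite -integZ// -LZ//.
  have -> : (fun x => n%:R * f x) = (fun x => \sum_(k < n) fk k x).
    by apply/funext => x; rewrite sumfk.
  rewrite isum Lsum// /n big_ord_recl/=; apply: lerD => //.
  rewrite [leRHS]big_ord_recr/=.
  rewrite -[leLHS]addr0; apply: lerD.
    by apply: ler_sum => i _; exact: step.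
  by apply: Lge0 => // x; have /andP[] := fk01 (Num.truncn e^-1) x.
rewrite -(ler_pM2l n0); apply: le_trans main _.
rewrite mulrDr addrC lerD2l -ler_pdivrMl// mulr1; exact: ltW.
Qed.

(** An affine change brings a bounded function into [[0, 1]], where [integ_le_L] applies; the
    inequality for [- f] is the converse one. *)
Lemma riesz_integ f : dcontinuous d f -> integ riesz_proba f = L f.
Proof.
have le g : dcontinuous d g -> integ riesz_proba g <= L g.
  move=> cg; have [B B0 gB] := dcontinuous_bounded dm dc cg.
  have C0 : 0 < 2 * (B + 1) by lra.
  have c1 : dcontinuous d (fun=> B + 1) by exact: dcontinuous_cst.
  pose h x := (2 * (B + 1))^-1 * (g x + (B + 1)).
  have ch : dcontinuous d h by apply: dcontinuousZ; exact: dcontinuousD.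
  have h01 x : 0 <= h x <= 1.
    rewrite /h mulrC divr_ge0 ?(ltW C0)//=; last by have := gB x; rewrite ler_norml; lra.
    by rewrite ler_pdivrMr// mul1r; have := gB x; rewrite ler_norml; lra.
  have := integ_le_L ch h01; rewrite /h integZ//; last exact: dcontinuousD.
  rewrite LZ//; last exact: dcontinuousD.
  by rewrite ler_pM2l ?invr_gt0// integD// LD// integ_cst Lcst lerD2r.
move=> cf; apply/eqP; rewrite eq_le le//=.
have := le _ (dcontinuousZ (-1) cf); rewrite integZ// LZ//.
by rewrite !mulN1r lerN2.
Qed.

Lemma riesz_representation :
  exists mu : Delta d, forall f, dcontinuous d f -> integ mu f = L f.
Proof. by exists riesz_proba; exact: riesz_integ. Qed.

End Riesz.

(** * Affine functionals on finitely supported measures *)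

Section AffineFinite.
Context {R : realType} {X : pointedType}.
Variable d : X -> X -> R.
Hypothesis dm : is_metric d.
Implicit Types (u v : X -> R) (mu nu : Delta d).

Lemma representsE u (A : set X) : finite_set (supp u) ->
  \sum_(x \in supp u `&` A) u x = integ_fs u \1_A.
Proof.
move=> /finite_supp_carries[s cs]; rewrite (integ_fsE _ cs) fsbig_mkcondr.
case: cs => us cu; rewrite (fsbig_fwiden s) //.
- apply: eq_bigr => x _; rewrite /patch indicE; case: ifPn => _; first by rewrite mulr1.
  by rewrite mulr0.
- move=> x /= [_ /negP]; rewrite negbK => /eqP ux0.
  by rewrite /patch ux0; case: ifPn.
Qed.

(** The weight 1 in [is_affine] already identifies measures that agree on measurable sets. *)
Lemma affine_eq (w : Delta d -> R) mu nu : is_affine w ->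
  (forall A : set (Xb d), measurable A -> mu A = nu A) -> w mu = w nu.
Proof.
move=> aw e; have := aw nu nu mu 1; rewrite lexx ler01 subrr mul1r mul0r addr0.
by apply => // A mA; rewrite e// mul1e mul0e adde0.
Qed.

(** Induction on the carrying list: split off the atom at [x] and renormalize the rest into [v]. A
    full atom, where this is impossible, is a Dirac mass. *)
Lemma affine_represents (w : Delta d -> R) u mu : is_affine w -> is_fsprob u ->
  represents mu u -> w mu = integ_fs u (fun x => w (diracX d x)).
Proof.
move=> aw pu; have [s cs] := fsprob_carries pu.
elim: s => [|x s IH] in u mu pu cs *.
  by have := integ_fs_cst 1 pu; rewrite (integ_fsE _ cs) big_nil => /eqP; rewrite eq_sym oner_eq0.
move=> ru; have u0 y : 0 <= u y by case: pu.
have [us cu] := cs; move: us => /= /andP[xs us].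
have s1 : u x + \sum_(y <- s) u y = 1.
  rewrite -[RHS](integ_fs_cst 1 pu) (integ_fsE _ cs) big_cons mulr1.
  by congr +%R; apply: eq_bigr => y _; rewrite mulr1.
have muE A : measurable A -> mu A = (integ_fs u \1_A)%:E.
  by move=> mA; rewrite ru// representsE//; case: pu.
have s0 : 0 <= \sum_(y <- s) u y by apply: sumr_ge0.
have [ux1|ux1] := eqVneq (u x) 1.
  have us0 y : y \in s -> u y = 0.
    move=> ys; have : \sum_(y <- s) u y = 0 by move: s1; rewrite ux1; lra.
    by move=> /eqP; rewrite psumr_eq0// => /allP/(_ y ys)/eqP.
  have uE f : integ_fs u f = f x.
    rewrite (integ_fsE _ cs) big_cons ux1 mul1r big_seq big1 ?addr0// => y ys.
    by rewrite us0// mul0r.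
  rewrite uE; apply: affine_eq => // A mA.
  by rewrite muE// uE /= diracE indicE.
have lx1 : u x < 1 by rewrite lt_neqAle ux1/=; lra.
pose v y := if y == x then 0 else u y / (1 - u x).
have cv : carries s v.
  split=> // y; rewrite /v; case: (y =P x) => [_|/eqP yx]; first by rewrite eqxx.
  rewrite mulf_eq0 negb_or => /andP[/cu + _]; rewrite inE (negbTE yx).
  exact.
have uv f : integ_fs u f = u x * f x + (1 - u x) * integ_fs v f.
  rewrite (integ_fsE _ cs) big_cons (integ_fsE _ cv) mulr_sumr; congr (_ + _).
  apply: eq_big_seq => y ys; rewrite /v; case: eqP => [yx|_]; first by rewrite -yx ys in xs.
  by field; lra.
have pv : is_fsprob v.
  split; [|exact: carries_finite_supp cv|].
    by move=> y; rewrite /v; case: eqP => // _; rewrite divr_ge0//; lra.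
  rewrite fsprob_sumE; have := uv (cst 1); rewrite (integ_fs_cst 1 pu) mulr1 => h.
  by apply: (@mulfI _ (1 - u x)); [lra|rewrite mulr1; lra].
have [mv rv] := fsprob_represented d pv.
rewrite uv -(IH v mv pv cv rv); apply: aw; first by rewrite u0 ltW.
move=> A mA; rewrite muE// uv EFinD !EFinM; congr (_ * _ + _ * _)%E.
by rewrite rv// representsE//; case: pv.
Qed.

End AffineFinite.

(** * Dynamic programming with finitely many stage weights *)

Section DynamicProgramming.
Context {R : realType} {X : pointedType}.
Variables (d : X -> X -> R) (F : X -> set (X -> R)).
Hypothesis dm : is_metric d.
Hypothesis dc : dcompact d.
Hypothesis F0 : forall x, exists u, F x u.
Hypothesis Fp : forall x u, F x u -> is_fsprob u.
Hypothesis Fne : forall x x' u, F x u -> exists2 u', F x' u' & dKR_fs d u u' <= d x x'.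
Implicit Types (r f g h : X -> R) (u v : X -> R) (th : nat -> R).

Definition bnd f := exists B, forall x, `|f x| <= B.

Lemma bndD f g : bnd f -> bnd g -> bnd (fun x => f x + g x).
Proof.
move=> [B fB] [C gC]; exists (B + C) => x.
by apply: le_trans (ler_normD _ _) _; exact: lerD.
Qed.

Lemma bndZ c f : bnd f -> bnd (fun x => c * f x).
Proof. by move=> [B fB]; exists (`|c| * B) => x; rewrite normrM ler_wpM2l. Qed.

(** The supremum runs over [F x] alone: the integral is linear in [u], so the convex hull gives the
    same value. *)
Definition maxF f x : R := sup [set integ_fs u f | u in F x].

Lemma maxF_has_sup f x : bnd f -> has_sup [set integ_fs u f | u in F x].
Proof.
move=> [B fB]; split; first by have [u Fu] := F0 x; exists (integ_fs u f), u.
exists B => _ [u Fu <-]; have /andP[//] : - B <= integ_fs u f <= B.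
by apply: integ_fs_bound (Fp Fu) _ => y; rewrite -ler_norml.
Qed.

Lemma maxF_ub f x u : bnd f -> F x u -> integ_fs u f <= maxF f x.
Proof. by move=> bf Fu; apply: ub_le_sup; [exact: (maxF_has_sup x bf).2|exists u]. Qed.

Lemma maxF_le f x c : bnd f -> (forall u, F x u -> integ_fs u f <= c) -> maxF f x <= c.
Proof.
move=> bf h; apply: ge_sup; first exact: (maxF_has_sup x bf).1.
by move=> _ [u Fu <-]; exact: h.
Qed.

Lemma maxF_near f x e : bnd f -> 0 < e -> exists2 u, F x u & maxF f x - e <= integ_fs u f.
Proof.
move=> bf e0; have [_ [u Fu <-] h] := sup_adherent e0 (maxF_has_sup x bf).
by exists u => //; exact: ltW.
Qed.

Lemma maxF_dist f g x e : bnd f -> bnd g -> (forall y, `|f y - g y| <= e) ->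
  `|maxF f x - maxF g x| <= e.
Proof.
have h f' g' : bnd f' -> bnd g' -> (forall y, `|f' y - g' y| <= e) ->
    maxF f' x <= maxF g' x + e.
  move=> bf bg fg; apply: maxF_le => // u Fu.
  have := integ_fs_dist (Fp Fu) fg; rewrite ler_norml => /andP[_].
  by have := maxF_ub bg Fu; lra.
move=> bf bg fg; have h1 := h _ _ bf bg fg.
have h2 : maxF g x <= maxF f x + e by apply: h => // y; rewrite distrC.
by rewrite ler_norml; lra.
Qed.

Lemma dKR_fs_lip u v L f : is_fsprob u -> is_fsprob v -> 0 <= L ->
  (forall x y, `|f x - f y| <= L * d x y) ->
  `|integ_fs u f - integ_fs v f| <= L * dKR_fs d u v.
Proof.
move=> pu pv; rewrite le_eqVlt => /orP[/eqP <-|L0] Lf.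
  have -> : f = fun=> f point.
    apply/funext => x; apply/eqP; rewrite -subr_eq0 -normr_le0.
    by rewrite (le_trans (Lf _ _))// mul0r.
  by rewrite !integ_fs_cst// subrr normr0 mul0r.
(* The supremum defining [dKR_fs] must be shown to be over a bounded set: by compactness a
   1-Lipschitz function stays within a fixed [D] of its value at [point]. *)
have cd : dcontinuous d (fun x => d x point).
  apply: (@dcontinuous_lip _ _ _ dm 1) => x y; rewrite mul1r ler_norml.
  have := dtri dm x y point; have := dtri dm y x point.
  by rewrite (dC dm y x); lra.
have [D D0 hD] := dcontinuous_bounded dm dc cd.
have ub : has_ubound [set `|integ_fs u f - integ_fs v f| | f in lip1 d].
  exists (D + D) => _ [g lg <-].
  have gd y : `|g y - g point| <= D.
    by apply: le_trans (lg _ _) _; apply: le_trans (hD y); exact: ler_norm.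
  have hu := integ_fs_dist pu gd; have hv := integ_fs_dist pv gd.
  rewrite !integ_fs_cst// in hu hv.
  move: hu hv; rewrite !ler_norml => /andP[? ?] /andP[? ?].
  by apply/andP; split; lra.
rewrite -ler_pdivrMl//; apply: ub_le_sup => //; exists (fun x => L^-1 * f x).
  move=> x y; rewrite -mulrBr normrM ger0_norm ?invr_ge0 ?(ltW L0)//.
  by rewrite ler_pdivrMl.
by rewrite !integ_fsZ// -mulrBr normrM ger0_norm// invr_ge0 ltW.
Qed.

(* The only place where nonexpansiveness of the house enters: the Bellman
   operator preserves Lipschitz constants. *)
Lemma maxF_lip f L : bnd f -> 0 <= L -> (forall x y, `|f x - f y| <= L * d x y) ->
  forall x y, `|maxF f x - maxF f y| <= L * d x y.
Proof.
move=> bf L0 Lf; have h x y : maxF f x <= maxF f y + L * d x y.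
  apply: maxF_le => // u Fu; have [u' Fu' duu'] := Fne y Fu.
  have := dKR_fs_lip (Fp Fu) (Fp Fu') L0 Lf; rewrite ler_norml => /andP[_].
  have := maxF_ub bf Fu'; have : L * dKR_fs d u u' <= L * d x y by rewrite ler_wpM2l.
  by lra.
move=> x y; rewrite ler_norml; have := h x y; have := h y x.
by rewrite (dC dm y x); lra.
Qed.

(* [bellman r th n x] is the value of the [n]-stage problem with stage weights
   [th 0, ..., th n.-1]. *)
Fixpoint bellman r th n : X -> R :=
  if n is m.+1 then maxF (fun y => th 0%N * r y + bellman r (th \o succn) m y)
  else fun=> 0.

Section Bounded.
Variable r : X -> R.
Hypothesis r01 : forall x, 0 <= r x <= 1.

Let rn1 x : `|r x| <= 1.
Proof. by rewrite ger0_norm; have /andP[] := r01 x. Qed.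

Let bndr : bnd r. Proof. by exists 1. Qed.

Lemma bellman_norm th n x : `|bellman r th n x| <= \sum_(t < n) `|th t|.
Proof.
elim: n => [|n IH] in th x *; first by rewrite big_ord0 normr0.
have bn y : `|th 0%N * r y + bellman r (th \o succn) n y| <= \sum_(t < n.+1) `|th t|.
  rewrite big_ord_recl/=; apply: le_trans (ler_normD _ _) _; apply: lerD; last exact: IH.
  by rewrite normrM ler_piMr.
have b : bnd (fun y => th 0%N * r y + bellman r (th \o succn) n y).
  by exists (\sum_(t < n.+1) `|th t|).
have ib v : F x v -> - (\sum_(t < n.+1) `|th t|) <=
    integ_fs v (fun y => th 0%N * r y + bellman r (th \o succn) n y) <=
    \sum_(t < n.+1) `|th t|.
  by move=> Fv; apply: integ_fs_bound (Fp Fv) _ => y; rewrite -ler_norml.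
have [u Fu] := F0 x; rewrite ler_norml; apply/andP; split.
  by apply: le_trans (maxF_ub b Fu); have /andP[] := ib u Fu.
by apply: maxF_le => // v /ib/andP[].
Qed.

Lemma bellman_bnd th n : bnd (bellman r th n).
Proof. by exists (\sum_(t < n) `|th t|) => x; exact: bellman_norm. Qed.

Lemma bellman_step_bnd th n :
  bnd (fun y => th 0%N * r y + bellman r (th \o succn) n y).
Proof. by apply: bndD; [exact: bndZ|exact: bellman_bnd]. Qed.

Lemma bellman_bound th n x : (forall t, 0 <= th t) ->
  0 <= bellman r th n x <= \sum_(t < n) th t.
Proof.
move=> th0; apply/andP; split; last first.
  apply: le_trans (ler_norm _) _; apply: le_trans (bellman_norm _ _ _) _.
  by apply: ler_sum => t _; rewrite ger0_norm.
elim: n => [//|n IH] in th th0 x *; have [u Fu] := F0 x.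
apply: le_trans (maxF_ub (bellman_step_bnd th n) Fu).
rewrite -(integ_fs_cst 0 (Fp Fu)); apply: ler_integ_fs (Fp Fu) _ => y.
apply: addr_ge0; last by apply: IH => t; exact: th0.
by rewrite mulr_ge0//; have /andP[] := r01 y.
Qed.

Lemma bellman_dist th th' n x :
  `|bellman r th n x - bellman r th' n x| <= \sum_(t < n) `|th t - th' t|.
Proof.
elim: n => [|n IH] in th th' x *; first by rewrite big_ord0 subrr normr0.
apply: maxF_dist; [exact: bellman_step_bnd|exact: bellman_step_bnd|] => y.
rewrite big_ord_recl/= opprD addrACA -mulrBl.
apply: le_trans (ler_normD _ _) _; apply: lerD; last exact: IH.
by rewrite normrM ler_piMr.
Qed.

Lemma bellman_horizon th n x : `|bellman r th n.+1 x - bellman r th n x| <= `|th n|.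
Proof.
elim: n => [|n IH] in th x *.
  by rewrite subr0; apply: le_trans (bellman_norm _ _ _) _; rewrite big_ord1.
apply: (@maxF_dist (fun y => th 0%N * r y + bellman r (th \o succn) n.+1 y)
  (fun y => th 0%N * r y + bellman r (th \o succn) n y));
  [exact: bellman_step_bnd|exact: bellman_step_bnd|] => y.
by rewrite opprD addrACA subrr add0r; exact: IH.
Qed.

Lemma bellman_zero_tail th n m x : (forall t, (n <= t)%N -> th t = 0) ->
  (n <= m)%N -> bellman r th m x = bellman r th n x.
Proof.
move=> tl; elim: m => [|m IH]; first by rewrite leqn0 => /eqP ->.
rewrite leq_eqVlt => /orP[/eqP ->//|]; rewrite ltnS => nm.
rewrite -(IH nm); apply/eqP; rewrite -subr_eq0 -normr_le0.
by have := bellman_horizon th m x; rewrite tl// normr0.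
Qed.

(** Moving by [u] leads to the problem with shifted weights. Returning to [th] costs its variation,
    and the reward of the first stage is at most [|th 0|] in absolute value. For small impatience
    the value is thus almost excessive. *)
Lemma bellman_excess th n x u : F x u -> integ_fs u (bellman r th n) <=
  bellman r th n.+1 x + `|th 0%N| + \sum_(t < n) `|th t.+1 - th t|.
Proof.
move=> Fu; have pu := Fp Fu.
have h1 := maxF_ub (bellman_step_bnd th n) Fu.
have := integ_fs_dist pu (fun y => bellman_dist (th \o succn) th n y).
rewrite ler_norml /= => /andP[h2 _].
rewrite integ_fsD// integ_fsZ// in h1.
have h3 : - `|th 0%N| <= th 0%N * integ_fs u r.
  have /andP[i0 i1] := integ_fs_bound pu r01.
  have : `|th 0%N * integ_fs u r| <= `|th 0%N| by rewrite normrM ler_piMr// ger0_norm.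
  by rewrite ler_norml => /andP[].
by move: h1 h2 h3 => /=; lra.
Qed.

Lemma bellman_Fhat th n z z' : is_fsprob z -> Fhat F z z' ->
  integ_fs z' (fun y => th 0%N * r y + bellman r (th \o succn) n y) <=
  integ_fs z (bellman r th n.+1).
Proof.
move=> pz /(Fhat_le Fp pz); apply => x p Fxp.
exact: maxF_ub (bellman_step_bnd th n) Fxp.
Qed.

(** For a fixed strategy the payoff is linear in the weights, and a supremum of linear functions is
    convex. The minmax step uses this to bound the value of a mixture of weightings. *)
Lemma bellman_convex (J : finType) (q : J -> R) (th : J -> nat -> R) n x :
  (forall j, 0 <= q j) ->
  bellman r (fun t => \sum_j q j * th j t) n x <= \sum_j q j * bellman r (th j) n x.
Proof.
move=> q0; elim: n => [|n IH] in th x *; first by rewrite big1// => j _; rewrite mulr0.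
apply: maxF_le; first exact: bellman_step_bnd.
move=> u Fu; have pu := Fp Fu.
apply: (@le_trans _ _ (\sum_j q j * integ_fs u
    (fun y => th j 0%N * r y + bellman r (th j \o succn) n y))); last first.
  apply: ler_sum => j _; apply: ler_wpM2l => //.
  exact: maxF_ub (bellman_step_bnd _ _) Fu.
have [s cs] := fsprob_carries pu.
rewrite (integ_fsE _ cs).
under [leRHS]eq_bigr do rewrite (integ_fsE _ cs) mulr_sumr.
rewrite exchange_big/=; apply: ler_sum => y _.
under [leRHS]eq_bigr do rewrite mulrCA.
rewrite -mulr_sumr; apply: ler_wpM2l; first by case: pu.
under [leRHS]eq_bigr do rewrite mulrDr.
rewrite big_split/=; apply: lerD; last exact: (IH (fun j => th j \o succn)).
by rewrite mulr_suml; apply: ler_sum => j _; rewrite mulrA.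
Qed.

(** Unlike a play, a path has its initial state as entry 0, so rewards are collected from entry 1
    on. *)
Definition fpath u (us : nat -> X -> R) :=
  us 0%N = u /\ forall t, Fhat F (us t) (us t.+1).

Lemma fpath_fsprob u us : is_fsprob u -> fpath u us -> forall t, is_fsprob (us t).
Proof.
move=> pu [us0 usS]; elim=> [|t IH]; first by rewrite us0.
exact: (Fhat_fsprob Fp) IH (usS t).
Qed.

Lemma fpath_ex u : exists us, fpath u us.
Proof.
have /choice[k hk] := Fhat_ex (F := F) F0.
by exists (fun t => iter t k u); split => // t; exact: hk.
Qed.

Lemma fpath_cons u v us : Fhat F u v -> fpath v us ->
  fpath u (fun t => if t is t'.+1 then us t' else u).
Proof. by move=> uv [us0 usS]; split => // -[|t]; rewrite ?us0. Qed.

Lemma fpath_play x us : fpath (dirac_fs x) us -> is_play F x (fun t => us t.+1).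
Proof.
move=> [us0 usS]; split; last by move=> t; exact: usS.
by rewrite -(Fhat_dirac F0) -us0; exact: usS.
Qed.

Lemma bellman_near_opt th N n u e : is_fsprob u -> 0 < e -> exists2 us, fpath u us &
  integ_fs u (bellman r th (N + n)) - e <=
  \sum_(t < N) th t * integ_fs (us t.+1) r +
    integ_fs (us N) (bellman r (fun t => th (N + t)%N) n).
Proof.
elim: N => [|N IH] in th u e *; move=> pu e0.
  have [us hus] := fpath_ex u; exists us => //; rewrite big_ord0 add0r.
  by case: hus => -> _; rewrite lerBlDr lerDl ltW.
(* Half of the error goes to the first move, half to the remaining stages. *)
have e2 : 0 < e / 2 by rewrite divr_gt0.
have [v uv hv] := Fhat_near_opt Fp pu e2
  (fun x => maxF_near x (bellman_step_bnd th (N + n)) e2).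
have pv := Fhat_fsprob Fp pu uv.
have [us vus hus] := IH (th \o succn) v _ pv e2.
exists (fun t => if t is t'.+1 then us t' else u); first exact: fpath_cons vus.
rewrite big_ord_recl /= (vus.1).
rewrite integ_fsD// integ_fsZ// in hv.
rewrite -[X in _ <= _ + X + _]/(\sum_(i < N) (th \o succn) i * integ_fs (us i.+1) r).
by move: hv hus => /=; lra.
Qed.

End Bounded.

Lemma bellman_dist_r r r' th n x e :
  (forall x, 0 <= r x <= 1) -> (forall x, 0 <= r' x <= 1) ->
  (forall y, `|r y - r' y| <= e) -> (forall t, 0 <= th t) ->
  `|bellman r th n x - bellman r' th n x| <= e * \sum_(t < n) th t.
Proof.
move=> r01 r01' rr'; elim: n => [|n IH] in th x *; move=> th0.
  by rewrite big_ord0 subrr normr0 mulr0.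
apply: maxF_dist; [exact: bellman_step_bnd|exact: bellman_step_bnd|] => y.
rewrite big_ord_recl/= mulrDr opprD addrACA -mulrBr.
apply: le_trans (ler_normD _ _) _; apply: lerD; last by apply: IH => t; exact: th0.
by rewrite normrM (ger0_norm (th0 _)) mulrC ler_wpM2r.
Qed.

Lemma bellman_lip r th n L : (forall x, 0 <= r x <= 1) -> (forall t, 0 <= th t) ->
  0 <= L -> (forall x y, `|r x - r y| <= L * d x y) ->
  forall x y, `|bellman r th n x - bellman r th n y| <= (L * \sum_(t < n) th t) * d x y.
Proof.
move=> r01 + L0 Lr; elim: n => [|n IH] in th *; move=> th0 x y.
  by rewrite subrr normr0 big_ord0 mulr0 mul0r.
apply: maxF_lip; [exact: bellman_step_bnd|by rewrite mulr_ge0// sumr_ge0|] => a b.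
rewrite big_ord_recl/= mulrDr mulrDl opprD addrACA -mulrBr.
apply: le_trans (ler_normD _ _) _; apply: lerD; last by apply: IH => t; exact: th0.
by rewrite normrM (ger0_norm (th0 _)) [leRHS]mulrAC [leRHS]mulrC ler_wpM2l.
Qed.

(** Replace [r] by a Lipschitz function of constant [L]: the values then have constant at most [L]
    for all weights of mass at most 1. The modulus is therefore common to all weightings and
    horizons. *)
Lemma bellman_equicont r e : (forall x, 0 <= r x <= 1) -> dcontinuous d r -> 0 < e ->
  exists2 a, 0 < a & forall th n, (forall t, 0 <= th t) -> \sum_(t < n) th t <= 1 ->
    forall x y, d x y < a -> `|bellman r th n x - bellman r th n y| <= e.
Proof.
move=> r01 cr e0; have e4 : 0 < e / 4 by rewrite divr_gt0.
have [L L0 [h hL hP]] := lip_approx dm dc r01 cr e4.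
have h01 x := (hP x).1; have rh x := (hP x).2.
have L1 : 0 < L + 1 by lra.
exists (e / 4 / (L + 1)); first by rewrite divr_gt0.
move=> th n th0 th1 x y xy.
have s0 : 0 <= \sum_(t < n) th t by apply: sumr_ge0.
have h1 := bellman_dist_r n x r01 h01 rh th0.
have h2 := bellman_dist_r n y r01 h01 rh th0.
have h3 := bellman_lip n h01 th0 L0 hL x y.
have b1 : e / 4 * \sum_(t < n) th t <= e / 4 by rewrite ler_piMr// ltW.
have b2 : (L * \sum_(t < n) th t) * d x y <= e / 4.
  apply: (@le_trans _ _ ((L + 1) * d x y)); last by rewrite mulrC -ler_pdivlMr// ltW.
  apply: ler_wpM2r; first exact: dge0.
  by apply: (@le_trans _ _ L); [rewrite ler_piMr|lra].
move: h1 h2 h3; rewrite !ler_norml => /andP[? ?] /andP[? ?] /andP[? ?].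
by apply/andP; split; lra.
Qed.

End DynamicProgramming.

(** * Evaluations, their tails and their impatience *)

Section Evaluations.
Context {R : realType}.
Implicit Types (th a : nat -> R).

Lemma nneseries_fin_le (a : nat -> R) (c : R) : (forall t, 0 <= a t) ->
  (forall n, \sum_(t < n) a t <= c) -> (\sum_(t <oo) (a t)%:E <= c%:E)%E.
Proof.
move=> a0 h; apply: lime_le; first by apply: is_cvg_nneseries => t _ _; rewrite lee_fin.
by apply: nearW => n; rewrite sumEFin lee_fin big_mkord.
Qed.

Lemma partial_le_nneseries (a : nat -> R) n : (forall t, 0 <= a t) ->
  ((\sum_(t < n) a t)%:E <= \sum_(t <oo) (a t)%:E)%E.
Proof.
move=> a0; rewrite -sumEFin -(big_mkord xpredT (fun t => (a t)%:E)).
by apply: nneseries_lim_ge => t _ _; rewrite lee_fin.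
Qed.

Lemma eval_partial th n : is_eval th -> \sum_(t < n) th t <= 1.
Proof. by move=> [th0 th1]; rewrite -lee_fin -th1; exact: partial_le_nneseries. Qed.

Lemma eval_tail th e : is_eval th -> 0 < e -> exists n, 1 - e < \sum_(t < n) th t.
Proof.
move=> [th0 th1] e0; apply: contrapT => h.
have : (\sum_(t <oo) (th t)%:E <= (1 - e)%:E)%E.
  apply: nneseries_fin_le => // n; rewrite leNgt; apply/negP => hn.
  by apply: h; exists n.
by rewrite th1 lee_fin; lra.
Qed.

Lemma impatience_partial th c n : (impatience th <= c%:E)%E ->
  \sum_(t < n) `|th t.+1 - th t| <= c.
Proof.
move=> h; rewrite -lee_fin; apply: le_trans h.
by apply: (@partial_le_nneseries (fun t => `|th t.+1 - th t|)).
Qed.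

(** If [th t > c], every later weight is at least [th t - c > 0], and enough of them sum to more
    than 1. *)
Lemma eval_le_variation th c t : is_eval th ->
  (forall n, \sum_(t < n) `|th t.+1 - th t| <= c) -> th t <= c.
Proof.
move=> ev hc; have th0 : forall t, 0 <= th t by case: ev.
have hk k : th t - th (t + k)%N <= c.
  apply: le_trans (hc (t + k)%N).
  rewrite -(big_mkord xpredT (fun i => `|th i.+1 - th i|)) (@big_cat_nat _ _ _ t)//= ?leq_addr//.
  rewrite -[leLHS]add0r; apply: lerD; first exact: sumr_ge0.
  elim: k => [|k IH]; first by rewrite addn0 subrr sumr_ge0.
  rewrite addnS big_nat_recr/= ?leq_addr//; move: IH.
  have := ler_norm (th (t + k)%N - th (t + k).+1); rewrite distrC.
  by lra.
rewrite leNgt; apply/negP => ct.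
have c0 : 0 < th t - c by lra.
pose N := (Num.truncn (th t - c)^-1).+1.
have : N%:R * (th t - c) <= 1.
  apply: le_trans (eval_partial (t + N) ev).
  rewrite big_split_ord/= -[leLHS]add0r; apply: lerD; first exact: sumr_ge0.
  rewrite mulr_natl -[N in _ *+ N]card_ord -sumr_const.
  by apply: ler_sum => k _; have := hk k; lra.
rewrite leNgt => /negP; apply.
by rewrite -ltr_pdivrMr// mul1r; exact: truncnS_gt.
Qed.

Lemma variation_le_impatience th c : (forall n, \sum_(t < n) `|th t.+1 - th t| <= c) ->
  (impatience th <= c%:E)%E.
Proof. exact: nneseries_fin_le. Qed.

Lemma abel_sum th (A : nat -> R) n :
  \sum_(t < n) th t * (A t - A t.+1) =
  th 0%N * A 0%N - th n * A n + \sum_(t < n) (th t.+1 - th t) * A t.+1.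
Proof.
elim: n => [|n IH]; first by rewrite !big_ord0 subrr add0r.
by rewrite !big_ord_recr/= IH; ring.
Qed.

End Evaluations.

(** * Payoffs of plays and their occupation measures *)

Section Payoffs.
Context {R : realType} {X : pointedType}.
Variables (F : X -> set (X -> R)) (r : X -> R).
Hypothesis F0 : forall x, exists u, F x u.
Hypothesis Fp : forall x u, F x u -> is_fsprob u.
Hypothesis r01 : forall x, 0 <= r x <= 1.
Implicit Types (th : nat -> R).

(** Rewards lie in [[0, 1]], so truncation costs at most the remaining mass. The series of a payoff
    is later handled only through this estimate. *)
Lemma payoff_bounds th x s n : is_eval th -> is_play F x s ->
  \sum_(t < n) th t * rbar r (s t) <= payoff r th s <=
  \sum_(t < n) th t * rbar r (s t) + (1 - \sum_(t < n) th t).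
Proof.
move=> ev ps; have th0 : forall t, 0 <= th t by case: ev.
have s01 t := integ_fs_bound (play_fsprob Fp ps t) r01.
have a0 t : 0 <= th t * rbar r (s t) by rewrite mulr_ge0//; have /andP[] := s01 t.
have a1 t : th t * rbar r (s t) <= th t by rewrite ler_piMr//; have /andP[] := s01 t.
have up : (\sum_(t <oo) (th t * rbar r (s t))%:E <=
    (\sum_(t < n) th t * rbar r (s t) + (1 - \sum_(t < n) th t))%:E)%E.
  apply: nneseries_fin_le => // m.
  apply: (@le_trans _ _ (\sum_(t < n + m) th t * rbar r (s t))).
    rewrite addnC big_split_ord/= lerDl; exact: sumr_ge0.
  rewrite big_split_ord/= lerD2l.
  have := eval_partial (n + m) ev; rewrite big_split_ord/=.
  have : \sum_(i < m) th (n + i)%N * rbar r (s (n + i)%N) <= \sum_(i < m) th (n + i)%N.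
    exact: ler_sum.
  by lra.
have lo := partial_le_nneseries n a0.
have fn : (\sum_(t <oo) (th t * rbar r (s t))%:E)%E \is a fin_num.
  apply/fin_numPlt; by rewrite (lt_le_trans _ lo) ?ltNyr//= (le_lt_trans up)// ltry.
by apply/andP; split; rewrite -lee_fin /payoff fineK.
Qed.

(* The occupation measure of a long play is almost invariant; the mass
   [1 - \sum_(t < T) th t] cut off by the truncation is put on the first stage. *)
Lemma occupation th x s a b : is_eval th -> (impatience th <= a%:E)%E ->
  is_play F x s -> 0 < b -> exists z z', [/\ is_fsprob z, Fhat F z z',
    (forall f B, (forall y, `|f y| <= B) ->
      `|integ_fs z f - integ_fs z' f| <= B * (3 * a + 2 * b)),
    payoff r th s <= integ_fs z r + b &
    (forall g, (forall y u, F y u -> integ_fs u g <= g y) -> integ_fs z g <= g x)].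
Proof.
move=> ev imp ps b0; have th0 : forall t, 0 <= th t by case: ev.
have p t := play_fsprob Fp ps t.
have [T hT] := eval_tail ev b0; have T1 := eval_partial T ev.
set m := \sum_(t < T) th t in hT T1.
pose lam (i : 'I_T.+1) := if (i < T)%N then th i else 1 - m.
(* [sh k] lists [T] consecutive stages from [k] on; its last index repeats stage [k] and carries the
   leftover mass. Thus [sh 1] follows [sh 0] by one transition, index by index. *)
pose sh k (i : 'I_T.+1) := if (i < T)%N then s (k + i)%N else s k.
have sumE (G : nat -> R) c : \sum_(i < T.+1) lam i * (if (i < T)%N then G i else c) =
    \sum_(i < T) th i * G i + (1 - m) * c.
  rewrite big_ord_recr /lam /= ltnn; congr (_ + _).
  by apply: eq_bigr => i _; rewrite ltn_ord.
have lam0 i : 0 <= lam i by rewrite /lam; case: ifP => // _; rewrite subr_ge0.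
have lam1 : \sum_i lam i = 1.
  have := sumE (fun=> 1) 1; rewrite mulr1.
  under eq_bigr do rewrite if_same mulr1.
  by under [in X in _ = X -> _]eq_bigr do rewrite mulr1; move=> ->; rewrite -/m; ring.
have psh k i : is_fsprob (sh k i) by rewrite /sh; case: ifP.
have fsh k i : finite_set (supp (sh k i)) by case: (psh k i).
have zE k f : integ_fs (mixt lam (sh k)) f =
    \sum_(t < T) th t * integ_fs (s (k + t)%N) f + (1 - m) * integ_fs (s k) f.
  rewrite integ_fs_mixt//.
  rewrite -(sumE (fun t => integ_fs (s (k + t)%N) f) (integ_fs (s k) f)).
  by apply: eq_bigr => i _; rewrite /sh; case: ifP.
exists (mixt lam (sh 0%N)), (mixt lam (sh 1%N)); split.
- exact: mixt_fsprob.
- apply: (Fhat_mixt F0 (F := F)) => // i; rewrite /sh; case: ifP => _;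
    by case: ps => _ h; exact: h.
- move=> f B fB; have B0 : 0 <= B by apply: le_trans (fB point).
  have sB t : `|integ_fs (s t) f| <= B.
    by rewrite ler_norml; apply: integ_fs_bound => // y; rewrite -ler_norml.
  have var n := impatience_partial n imp.
  have tha t : th t <= a by exact: eval_le_variation ev var.
  have -> : integ_fs (mixt lam (sh 0%N)) f - integ_fs (mixt lam (sh 1%N)) f =
      \sum_(t < T) th t * (integ_fs (s t) f - integ_fs (s t.+1) f) +
      (1 - m) * (integ_fs (s 0%N) f - integ_fs (s 1%N) f).
    rewrite !zE; under [X in _ = X + _]eq_bigr do rewrite mulrBr.
    by rewrite sumrB; ring.
  (* After Abel summation the two boundary terms and the variation contribute [a * B] each; the
     leftover mass, less than [b], contributes at most [2 * b * B]. *)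
  rewrite (abel_sum th (fun t => integ_fs (s t) f)).
  have thB t t' : `|th t * integ_fs (s t') f| <= a * B.
    by rewrite normrM ler_pM// ger0_norm.
  have h1 : `|\sum_(t < T) (th t.+1 - th t) * integ_fs (s t.+1) f| <= a * B.
    apply: le_trans (ler_norm_sum _ _ _) _.
    apply: (@le_trans _ _ ((\sum_(t < T) `|th t.+1 - th t|) * B)); last by rewrite ler_wpM2r.
    by rewrite mulr_suml; apply: ler_sum => t _; rewrite normrM ler_wpM2l.
  have h2 : `|(1 - m) * (integ_fs (s 0%N) f - integ_fs (s 1%N) f)| <= b * (B + B).
    rewrite normrM; apply: ler_pM => //; first by rewrite ger0_norm; lra.
    by apply: le_trans (ler_normB _ _) _; exact: lerD.
  have := thB 0%N 0%N; have := thB T T; move: h1 h2.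
  rewrite !ler_norml => /andP[? ?] /andP[? ?] /andP[? ?] /andP[? ?].
  by apply/andP; split; lra.
- rewrite zE; have /andP[_ h] := payoff_bounds T ev ps.
  apply: le_trans h _; rewrite -/m -addrA lerD//.
  have : 0 <= (1 - m) * integ_fs (s 0%N) r.
    rewrite mulr_ge0 ?subr_ge0//.
    by have /andP[] := integ_fs_bound (p 0%N) r01.
  by lra.
- move=> g hg; rewrite zE.
  (* An excessive function does not increase in expectation along a play. *)
  have sg t : integ_fs (s t) g <= g x.
    elim: t => [|t IH]; first by apply: conv_le (@Fp x) _ _ ps.1 => q; exact: hg.
    by apply: le_trans IH; apply: (Fhat_le Fp (p t) (ps.2 t)).
  rewrite [leRHS](_ : g x = m * g x + (1 - m) * g x); last by ring.
  apply: lerD.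
    by rewrite mulr_suml; apply: ler_sum => t _; rewrite ler_wpM2l.
  by rewrite ler_wpM2l// subr_ge0.
Qed.

End Payoffs.

(** * Weak limits of finitely supported probabilities *)

Section WeakLimits.
Context {R : realType} {X : pointedType}.
Variable d : X -> X -> R.
Hypothesis dm : is_metric d.
Hypothesis dc : dcompact d.

(** The limit of the integrals along [U] is a positive, linear and normalized functional, which the
    Riesz theorem represents. *)
Lemma weak_limit (U : set_system nat) (z : nat -> X -> R) : UltraFilter U ->
  (forall n, is_fsprob (z n)) ->
  exists mu : Delta d, forall f, dcontinuous d f ->
    integ_fs (z n) f @[n --> U] --> integ mu f.
Proof.
move=> UU pz; pose L f : R := lim (integ_fs (z n) f @[n --> U]).
have cvL f : dcontinuous d f -> integ_fs (z n) f @[n --> U] --> L f.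
  move=> cf; have [B B0 fB] := dcontinuous_bounded dm dc cf.
  apply: (@ultra_cvg _ U _ B) => // n.
  by rewrite ler_norml; apply: integ_fs_bound (pz n) _ => y; rewrite -ler_norml.
have Lu f l : integ_fs (z n) f @[n --> U] --> l -> L f = l.
  by move=> h; apply: cvg_lim => //; exact: norm_hausdorff.
have [||||mu hmu] := @riesz_representation _ _ d dm dc L.
- move=> f g cf cg; apply: Lu.
  under eq_fun do rewrite integ_fsD//.
  by apply: cvgD; exact: cvL.
- move=> c f cf; apply: Lu.
  under eq_fun do rewrite integ_fsZ//.
  by apply: cvgM; [exact: cvg_cst|exact: cvL].
- move=> f cf f0; apply: (limr_ge (F := U)).
    by apply/cvg_ex; exists (L f); exact: cvL.
  by apply: nearW => n; rewrite -(integ_fs_cst 0 (pz n)); exact: ler_integ_fs.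
- apply: Lu; under eq_fun do rewrite integ_fs_cst//.
  exact: cvg_cst.
by exists mu => f cf; rewrite hmu//; exact: cvL.
Qed.

End WeakLimits.

(** * Admissible functionals dominate the payoffs of patient plays *)

Section UpperBound.
Context {R : realType} {X : pointedType}.
Variables (d : X -> X -> R) (F : X -> set (X -> R)) (r : X -> R).
Hypothesis dm : is_metric d.
Hypothesis dc : dcompact d.
Hypothesis F0 : forall x, exists u, F x u.
Hypothesis Fp : forall x u, F x u -> is_fsprob u.
Hypothesis r01 : forall x, 0 <= r x <= 1.
Hypothesis cr : dcontinuous d r.

Lemma admissible_excessive (w : Delta d -> R) : admissible_w F r w ->
  forall y u, F y u -> integ_fs u (fun x => w (diracX d x)) <= w (diracX d y).
Proof.
move=> [_ aw _ w1 _] y u Fu; have [mu ru] := fsprob_represented d (Fp Fu).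
by rewrite -(affine_represents aw (Fp Fu) ru); exact: w1 Fu _ ru.
Qed.

(* Otherwise the occupation measures of plays violating the bound, for
   impatience tending to 0, accumulate at an invariant measure violating (2). *)
Lemma admissible_upper (w : Delta d -> R) (e : R) : admissible_w F r w -> 0 < e ->
  exists2 a : R, 0 < a & forall th, is_eval th -> (impatience th <= a%:E)%E ->
    forall x s, is_play F x s -> payoff r th s <= w (diracX d x) + e.
Proof.
move=> adw e0; have [w01 aw cw w1 w2] := adw.
apply: contrapT => nex.
pose a (n : nat) : R := n.+1%:R^-1.
have a0 n : 0 < a n by rewrite invr_gt0.
(* Bounding [w (diracX d x)] below by the average of [w] under [z] removes the starting point, which
   varies with [n]. The constant 5 is [3 + 2], as [occupation] is applied with [b] equal to
   [a n]. *)
have bad n : exists zz : (X -> R) * (X -> R), [/\ is_fsprob zz.1, Fhat F zz.1 zz.2,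
    (forall f B, (forall y, `|f y| <= B) ->
      `|integ_fs zz.1 f - integ_fs zz.2 f| <= B * (5 * a n)) &
    integ_fs zz.1 (fun x => w (diracX d x)) + e < integ_fs zz.1 r + a n].
  apply: contrapT => nz; apply: nex; exists (a n) => // th ev imp x s ps.
  rewrite leNgt; apply/negP => lt; apply: nz.
  have [z [z' [pz Fz zd pay exc]]] := occupation F0 Fp r01 ev imp ps (a0 n).
  exists (z, z'); split => //=.
    move=> f B fB; have -> : 5 * a n = 3 * a n + 2 * a n by ring.
    exact: zd.
  by have := exc _ (admissible_excessive adw); lra.
have /choice[zz hz] := bad.
pose z n := (zz n).1; pose z' n := (zz n).2.
have pz n : is_fsprob (z n) by case: (hz n).
have pz' n : is_fsprob (z' n) by case: (hz n) => _ h _ _; exact: (Fhat_fsprob Fp (pz n) h).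
have [U UU oU] := free_ultrafilter.
have [mu hmu] := weak_limit dm dc UU pz.
have asmall c : 0 < c -> \forall n \near U, a n < c.
  move=> c0; apply: oU; near=> n; rewrite /a invf_plt ?posrE//.
  apply: lt_le_trans (truncnS_gt _) _; rewrite ler_nat ltnS.
  by near: n; exists (Num.truncn c^-1).
have zclose f c : dcontinuous d f -> 0 < c ->
    \forall n \near U, `|integ_fs (z n) f - integ mu f| < c.
  move=> cf c0; have := hmu f cf => /cvgrPdist_lt/(_ c c0).
  by apply: filterS => n; rewrite distrC.
(* The integrals against [z n] and [z' n] differ by at most [5 * B * a n], so both sequences have
   the limit [mu]; this is what makes [mu] invariant. *)
have zclose' f c : dcontinuous d f -> 0 < c ->
    \forall n \near U, `|integ_fs (z' n) f - integ mu f| < c.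
  move=> cf c0; have [B B0 fB] := dcontinuous_bounded dm dc cf.
  have c2 : 0 < c / 2 by rewrite divr_gt0.
  have C0 : 0 < c / 2 / (5 * (B + 1)) by rewrite divr_gt0//; lra.
  have h1 := zclose f _ cf c2; have h2 := asmall _ C0.
  apply: filterS2 h1 h2 => n h1; rewrite ltr_pdivlMr; last by lra.
  move=> h2; have [_ _ /(_ f B fB) h3 _] := hz n.
  have h4 : B * (5 * a n) <= a n * (5 * (B + 1)) by have := a0 n; nra.
  move: h1 h3; rewrite ltr_norml ler_norml -/(z n) -/(z' n) => /andP[? ?] /andP[? ?].
  by rewrite ltr_norml; apply/andP; split; lra.
have inv : Defs.invariant F mu.
  move=> n fs gs delta delta0 cfg.
  have h : \forall m \near U, forall i, `|integ_fs (z m) (fs i) - integ mu (fs i)| < delta /\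
      `|integ_fs (z' m) (gs i) - integ mu (gs i)| < delta.
    apply: filter_forall => i; apply: filterI.
    - by apply: zclose => //; exact: (cfg i).1.
    - by apply: zclose' => //; exact: (cfg i).2.
  have [m hm] := filter_ex h.
  have [mz rz] := fsprob_represented d (pz m).
  have [mz' rz'] := fsprob_represented d (pz' m).
  exists (z m), (z' m), mz, mz'; split => //; first by case: (hz m).
  move=> i; rewrite (integ_represents dm dc (pz m) rz (cfg i).1).
  by rewrite (integ_represents dm dc (pz' m) rz' (cfg i).2); exact: hm.
have e4 : 0 < e / 4 by rewrite divr_gt0.
have [n [fs [delta [delta0 cfs hw]]]] := cw mu _ e4.
have h1 : \forall m \near U, forall i, `|integ_fs (z m) (fs i) - integ mu (fs i)| < delta.
  by apply: filter_forall => i; exact: zclose.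
have h2 := zclose r _ cr e4; have h3 := asmall _ e4.
have [m [[hm1 hm2] hm3]] := filter_ex (filterI (filterI h1 h2) h3).
have [mz rz] := fsprob_represented d (pz m).
have := hw mz; have := hz m; rewrite -/(z m) => -[_ _ _ hme].
rewrite -(affine_represents aw (pz m) rz) in hme.
have close i : `|integ mz (fs i) - integ mu (fs i)| < delta.
  by rewrite (integ_represents dm dc (pz m) rz (cfs i)); exact: hm1.
move=> /(_ close); have := w2 mu inv.
move: hm2 hm3 => /=; rewrite !ltr_norml => /andP[? ?] ? ? /andP[? ?].
by lra.
Unshelve. all: by end_near.
Qed.

End UpperBound.

(** * Ultralimits of values and their identification with [v*] *)

Section LimitValue.
Context {R : realType} {X : pointedType}.
Variables (d : X -> X -> R) (F : X -> set (X -> R)) (r : X -> R).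
Hypothesis dm : is_metric d.
Hypothesis dc : dcompact d.
Hypothesis F0 : forall x, exists u, F x u.
Hypothesis Fp : forall x u, F x u -> is_fsprob u.
Hypothesis r01 : forall x, 0 <= r x <= 1.
Hypothesis cr : dcontinuous d r.
Hypothesis Fne : forall x x' u, F x u -> exists2 u', F x' u' & dKR_fs d u u' <= d x x'.
Implicit Types (th : nat -> R).

Local Notation bellman := (bellman F r).

Definition is_feval th n := [/\ forall t, 0 <= th t, forall t, (n <= t)%N -> th t = 0 &
  \sum_(t < n) th t = 1].

Lemma feval_is_eval th n : is_feval th n -> is_eval th.
Proof.
move=> [th0 tl th1]; split => //; apply/eqP; rewrite eq_le; apply/andP; split.
  apply: nneseries_fin_le => // m; rewrite -th1.
  apply: (@le_trans _ _ (\sum_(t < n + m) th t)).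
    by rewrite addnC big_split_ord/= lerDl sumr_ge0.
  by rewrite big_split_ord/= [X in _ + X]big1 ?addr0// => i _; rewrite tl// leq_addr.
by rewrite -th1; exact: partial_le_nneseries.
Qed.

Lemma bellman_play th n x e : is_feval th n -> 0 < e ->
  exists2 s, is_play F x s & bellman th n x - e <= payoff r th s.
Proof.
move=> fe e0.
have [us pus] := bellman_near_opt F0 Fp r01 th n 0 (dirac_fsprob x) e0.
rewrite addn0 integ_dirac_fs /= integ_fs_cst; last first.
  exact: (fpath_fsprob Fp (dirac_fsprob x) pus).
rewrite addr0 => h; have ps := fpath_play F0 pus.
exists (fun t => us t.+1) => //; apply: le_trans h _.
by have /andP[] := payoff_bounds Fp r01 n (feval_is_eval fe) ps.
Qed.

Lemma bellman_dcontinuous th n : (forall t, 0 <= th t) -> \sum_(t < n) th t <= 1 ->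
  dcontinuous d (bellman th n).
Proof.
move=> th0 th1 x e e0; have e2 : 0 < e / 2 by rewrite divr_gt0.
have [a a0 ha] := bellman_equicont dm dc F0 Fp Fne r01 cr e2.
by exists a => // y xy; apply: le_lt_trans (ha th n th0 th1 _ _ xy) _; lra.
Qed.

(** Induction on the stages, with [mu] as a stationary distribution: approximate [(mu, mu)] by a
    pair [(z, z')] of the graph, test the first component on the value and the second on reward plus
    continuation, and apply the one-step inequality [bellman_Fhat]. *)
Lemma bellman_invariant (mu : Delta d) th n : Defs.invariant F mu ->
  (forall t, 0 <= th t) -> \sum_(t < n) th t <= 1 ->
  (\sum_(t < n) th t) * integ mu r <= integ mu (bellman th n).
Proof.
move=> inv; elim: n => [|n IH] in th *; move=> th0 th1.
  by rewrite big_ord0 mul0r /= integ_cst.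
have th0' t : 0 <= (th \o succn) t by exact: th0.
have th1' : \sum_(t < n) (th \o succn) t <= 1.
  by move: th1; rewrite big_ord_recl/=; have := th0 0%N; lra.
have cb := bellman_dcontinuous th0 th1; have cb' := bellman_dcontinuous th0' th1'.
have cz : dcontinuous d (fun y => th 0%N * r y) by exact: dcontinuousZ.
have cg : dcontinuous d (fun y => th 0%N * r y + bellman (th \o succn) n y).
  exact: dcontinuousD.
rewrite big_ord_recl mulrDl; apply: (@le_trans _ _
    (integ mu (fun y => th 0%N * r y + bellman (th \o succn) n y))).
  by rewrite integD// integZ// lerD2l; exact: IH.
apply/ler_addgt0Pr => e e0; have e2 : 0 < e / 2 by rewrite divr_gt0.
have [] := inv 1%N (fun=> bellman th n.+1)
  (fun=> fun y => th 0%N * r y + bellman (th \o succn) n y) _ e2; first by [].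
move=> z [z' [mz [mz' [pz zz' rz rz' /(_ ord0)]]]].
rewrite (integ_represents dm dc pz rz cb).
rewrite (integ_represents dm dc (Fhat_fsprob Fp pz zz') rz' cg).
have := bellman_Fhat F0 Fp r01 th n pz zz'.
by rewrite !ltr_norml => h [/andP[? ?] /andP[? ?]]; lra.
Qed.

Section Ultralimit.
Variables (U : set_system nat) (UU : UltraFilter U) (oU : \oo `<=` U).
Variables (th : nat -> nat -> R) (n : nat -> nat).
Hypothesis fe : forall k, is_feval (th k) (n k).
Hypothesis imp : forall k, (impatience (th k) <= (k.+1%:R^-1)%:E)%E.

Definition ulim x : R := lim (bellman (th k) (n k) x @[k --> U]).

Lemma bellman01 k x : 0 <= bellman (th k) (n k) x <= 1.
Proof. by have [th0 _ th1] := fe k; have := bellman_bound F0 Fp r01 (n k) x th0; rewrite th1. Qed.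

Lemma ulim_cvg x : bellman (th k) (n k) x @[k --> U] --> ulim x.
Proof.
apply: (@ultra_cvg _ U _ 1) => // k; have /andP[h0 h1] := bellman01 k x.
by rewrite ger0_norm.
Qed.

Lemma invS_near c : 0 < c -> \forall k \near U, k.+1%:R^-1 < c :> R.
Proof.
move=> c0; apply: oU; near=> k; rewrite invf_plt ?posrE//.
apply: lt_le_trans (truncnS_gt _) _; rewrite ler_nat ltnS.
by near: k; exists (Num.truncn c^-1).
Unshelve. all: by end_near.
Qed.

Lemma ulim_equicont e : 0 < e -> exists2 a, 0 < a & forall x y, d x y < a ->
  `|ulim x - ulim y| <= e /\
  forall k, `|bellman (th k) (n k) x - bellman (th k) (n k) y| <= e.
Proof.
move=> e0; have [a a0 ha] := bellman_equicont dm dc F0 Fp Fne r01 cr e0.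
have hk k x y : d x y < a -> `|bellman (th k) (n k) x - bellman (th k) (n k) y| <= e.
  by have [th0 _ th1] := fe k; apply: ha => //; rewrite th1.
exists a => // x y xy; split; last by move=> k; exact: hk.
apply/ler_addgt0Pr => c c0; have c2 : 0 < c / 2 by rewrite divr_gt0.
have /cvgrPdist_lt/(_ _ c2) h1 := @ulim_cvg x.
have /cvgrPdist_lt/(_ _ c2) h2 := @ulim_cvg y.
have [k [hx hy]] := filter_ex (filterI h1 h2).
move: hx hy (hk k x y xy) => /=; rewrite !ltr_norml !ler_norml.
by move=> /andP[? ?] /andP[? ?] /andP[? ?]; apply/andP; split; lra.
Qed.

Lemma ulim_dcontinuous : dcontinuous d ulim.
Proof.
move=> x e e0; have e2 : 0 < e / 2 by rewrite divr_gt0.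
have [a a0 ha] := ulim_equicont e2; exists a => // y /ha[h _].
by apply: le_lt_trans h _; lra.
Qed.

(** Convergence on a finite net spreads to [X] through the modulus common to the limit and all its
    approximants. *)
Lemma ulim_uniform e : 0 < e ->
  \forall k \near U, forall x, `|bellman (th k) (n k) x - ulim x| <= e.
Proof.
move=> e0; have e3 : 0 < e / 3 by rewrite divr_gt0.
have [a a0 ha] := ulim_equicont e3; have [s hs] := finite_net dm dc (fun=> a0).
have h : \forall k \near U, forall i : 'I_(size s),
    `|ulim (tnth (in_tuple s) i) - bellman (th k) (n k) (tnth (in_tuple s) i)| < e / 3.
  by apply: filter_forall => i; have /cvgrPdist_lt/(_ _ e3) := @ulim_cvg (tnth (in_tuple s) i).
apply: filterS h => k hk x; have [y ys yx] := hs x.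
have [i yi] : exists i, y = tnth (in_tuple s) i by apply/tnthP.
have := hk i; rewrite -yi; have [h1 /(_ k) h2] := ha _ _ yx.
move: h1 h2; rewrite !ltr_norml !ler_norml.
by move=> /andP[? ?] /andP[? ?] /andP[? ?]; apply/andP; split; lra.
Qed.

Lemma ulim01 x : 0 <= ulim x <= 1.
Proof.
have cx : cvg (bellman (th k) (n k) x @[k --> U]) by apply/cvg_ex; exists (ulim x); exact: ulim_cvg.
apply/andP; split.
  by apply: (limr_ge (F := U)) => //; apply: nearW => k; have /andP[] := bellman01 k x.
by apply: (limr_le (F := U)) => //; apply: nearW => k; have /andP[] := bellman01 k x.
Qed.

Lemma ulim_excessive y u : F y u -> integ_fs u ulim <= ulim y.
Proof.
move=> Fu; have pu := Fp Fu.
(* Four errors of [e / 4]: two uniform approximations, the first weight and the variation. *)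
apply/ler_addgt0Pr => e e0; have e4 : 0 < e / 4 by rewrite divr_gt0.
have [k [hk1 hk2]] := filter_ex (filterI (ulim_uniform e4) (invS_near e4)).
have [th0 tl th1] := fe k.
have var m := impatience_partial m (imp k).
have th00 := eval_le_variation 0 (feval_is_eval (fe k)) var.
have := bellman_excess F0 Fp r01 (th k) (n k) Fu.
rewrite (bellman_zero_tail F0 Fp r01 y tl (leqnSn _)) (ger0_norm (th0 _)).
have := integ_fs_dist pu hk1; have := hk1 y.
have := le_trans th00 (ltW hk2); have := le_trans (var (n k)) (ltW hk2).
by rewrite !ler_norml => ? ? /andP[? ?] /andP[? ?] ?; lra.
Qed.

Lemma ulim_invariant (mu : Delta d) : Defs.invariant F mu -> integ mu r <= integ mu ulim.
Proof.
move=> inv; apply/ler_addgt0Pr => e e0.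
have [k hk] := filter_ex (ulim_uniform e0); have [th0 tl th1] := fe k.
have cb : dcontinuous d (bellman (th k) (n k)) by apply: bellman_dcontinuous => //; rewrite th1.
have := bellman_invariant inv th0 (n := n k); rewrite th1 lexx mul1r => /(_ isT).
have := integ_dist dm dc mu cb ulim_dcontinuous hk.
by rewrite ler_norml => /andP[? ?] ?; lra.
Qed.

Lemma ulim_admissible : admissible_w F r (fun mu : Delta d => integ mu ulim).
Proof.
split.
- by move=> mu; apply: integ_bound ulim_dcontinuous ulim01.
- exact: integ_is_affine ulim_dcontinuous.
- exact: integ_weak_star_continuous ulim_dcontinuous.
- move=> y u Fu mu ru; rewrite (integ_represents dm dc (Fp Fu) ru ulim_dcontinuous).
  by rewrite integ_diracX//; [exact: ulim_excessive|exact: ulim_dcontinuous].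
- exact: ulim_invariant.
Qed.

(** The right side does not depend on the weightings, so all ultralimits coincide. The ultralimit is
    itself admissible, which gives one inequality; near-optimal plays for [th k], bounded by
    [admissible_upper], give the other. *)
Lemma ulim_vstar x : ulim x = vstar d F r x.
Proof.
have lb0 : lbound [set w (diracX d x) | w in admissible_w F r] 0.
  by move=> _ [w [w01 _ _ _ _] <-]; have /andP[] := w01 (diracX d x).
apply/eqP; rewrite eq_le; apply/andP; split; last first.
  rewrite -(integ_diracX x ulim_dcontinuous); apply: ge_inf; first by exists 0.
  by exists (fun mu => integ mu ulim) => //; exact: ulim_admissible.
apply: lb_le_inf.
  by exists (integ (diracX d x) ulim), (fun mu => integ mu ulim) => //; exact: ulim_admissible.
move=> _ [w adw <-]; apply/ler_addgt0Pr => e e0.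
have e3 : 0 < e / 3 by rewrite divr_gt0.
have [a a0 ha] := admissible_upper dm dc F0 Fp r01 cr adw e3.
have [k [hk1 hk2]] := filter_ex (filterI (ulim_uniform e3) (invS_near a0)).
have [s ps hs] := bellman_play x (fe k) e3.
have impa : (impatience (th k) <= a%:E)%E.
  by apply: le_trans (imp k) _; rewrite lee_fin ltW.
have := ha _ (feval_is_eval (fe k)) impa x s ps.
have := hk1 x; rewrite ler_norml => /andP[? ?] ?; lra.
Qed.

End Ultralimit.

Definition unif_weights (k t : nat) : R := if (t < k.+1)%N then k.+1%:R^-1 else 0.

Lemma unif_feval k : is_feval (unif_weights k) k.+1.
Proof.
rewrite /unif_weights; split=> [t|t|]; first by case: ifP => // _; rewrite invr_ge0.
  by move=> kt; rewrite ltnNge kt.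
under eq_bigr do rewrite ltn_ord.
by rewrite sumr_const card_ord -[_ *+ _]mulr_natl divff// pnatr_eq0.
Qed.

Lemma unif_impatience k : (impatience (unif_weights k) <= (k.+1%:R^-1)%:E)%E.
Proof.
have c0 : 0 <= k.+1%:R^-1 :> R by rewrite invr_ge0.
apply: variation_le_impatience => m.
apply: (@le_trans _ _ (if (k < m)%N then k.+1%:R^-1 else 0)); last by case: ifP.
elim: m => [|m IH]; first by rewrite big_ord0.
rewrite big_ord_recr/= /unif_weights !ltnS; apply: le_trans (lerD IH (lexx _)) _.
case: (ltngtP k m) => km.
- by rewrite subrr normr0 addr0.
- by rewrite subrr normr0 addr0.
- by rewrite add0r sub0r normrN ger0_norm.
Qed.

(** What matters is a single [w] for all [x]: [admissible_upper] applied to it gives a threshold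
    uniform in [x]. *)
Lemma vstar_admissible : exists2 w, admissible_w F r w &
  forall x, w (diracX d x) = vstar d F r x.
Proof.
have [U UU oU] := free_ultrafilter.
have adm := ulim_admissible UU oU unif_feval unif_impatience.
eexists; first exact: adm.
move=> x; rewrite /= integ_diracX; last exact: ulim_dcontinuous unif_feval.
exact: ulim_vstar unif_feval unif_impatience x.
Qed.

Lemma vstar_le1 x : vstar d F r x <= 1.
Proof. by have [w [w01 _ _ _ _] <-] := vstar_admissible; have /andP[] := w01 (diracX d x). Qed.

Lemma vstar_ge0 x : 0 <= vstar d F r x.
Proof. by have [w [w01 _ _ _ _] <-] := vstar_admissible; have /andP[] := w01 (diracX d x). Qed.

(** A sequence of counterexamples would have an ultralimit, which is [v*] by [ulim_vstar] and is
    approached uniformly. *)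
Lemma bellman_lower (e : R) : 0 < e -> exists2 a : R, 0 < a &
  forall th n, is_feval th n -> (impatience th <= a%:E)%E ->
    forall x, vstar d F r x - e <= bellman th n x.
Proof.
move=> e0; apply: contrapT => nex.
have bad (k : nat) : exists tn : (nat -> R) * nat, [/\ is_feval tn.1 tn.2,
    (impatience tn.1 <= (k.+1%:R^-1)%:E)%E &
    exists x, bellman tn.1 tn.2 x < vstar d F r x - e].
  apply: contrapT => nk; apply: nex; exists (k.+1%:R^-1); first by rewrite invr_gt0.
  move=> th n fe im x; rewrite leNgt; apply/negP => lt; apply: nk.
  by exists (th, n); split => //; exists x.
have /choice[tn htn] := bad.
have fe k : is_feval (tn k).1 (tn k).2 by case: (htn k).
have im k : (impatience (tn k).1 <= (k.+1%:R^-1)%:E)%E by case: (htn k).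
have [U UU oU] := free_ultrafilter.
have e2 : 0 < e / 2 by rewrite divr_gt0.
have [k hk] := filter_ex (ulim_uniform UU fe e2).
have [_ _ [x hx]] := htn k; have := hk x.
rewrite (ulim_vstar UU oU fe im) ler_norml => /andP[? ?]; lra.
Qed.

End LimitValue.

(** * A finite minmax inequality *)

Section Minmax.
Context {R : realType} {I : finType}.
Implicit Types (c q : I -> R) (C : set (I -> R)).

(* Minimize the squared distance of [C] to the orthant above [a]: the gap
   vector of an almost minimizer is a weight vector for which a better
   response decreases the distance. *)
Lemma convex_minmax C (a : R) (i0 : I) :
  (forall c c' s, C c -> C c' -> 0 <= s <= 1 -> C (fun i => (1 - s) * c i + s * c' i)) ->
  (forall c i, C c -> 0 <= c i <= 1) ->
  (forall q, (forall i, 0 <= q i) -> \sum_i q i = 1 -> forall e, 0 < e ->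
     exists2 c, C c & a - e <= \sum_i q i * c i) ->
  forall e, 0 < e -> exists2 c, C c & forall i, a - e <= c i.
Proof.
move=> Cconv C01 Cq.
pose g c i := Num.max (a - c i) 0.
pose phi c := \sum_i g c i ^+ 2.
have g0 c i : 0 <= g c i by rewrite le_max lexx orbT.
have phi0 c : 0 <= phi c by apply: sumr_ge0 => i _; exact: sqr_ge0.
have [c0 Cc0] : exists c, C c.
  have [||c Cc _] := Cq (fun i => (i == i0)%:R) _ _ 1 ltr01; last by exists c.
    by move=> i; rewrite ler0n.
  by rewrite (bigD1 i0)//= eqxx big1 ?addr0// => i /negbTE ->.
have hi : has_inf [set phi c | c in C].
  by split; [exists (phi c0), c0|exists 0 => _ [c _ <-]].
set M := inf [set phi c | c in C].
have Mle c : C c -> M <= phi c by move=> Cc; apply: ge_inf; [exact: hi.2|exists c].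
have M0 : 0 <= M by apply: lb_le_inf; [exact: hi.1|move=> _ [c _ <-]].
suff M00 : M = 0.
  move=> e e0; have [|_ [c Cc <-]] := @inf_adherent _ _ (e ^+ 2) _ hi.
    by rewrite exprn_gt0.
  rewrite -/M M00 add0r => lt; exists c => // i.
  have gi : g c i ^+ 2 < e ^+ 2.
    apply: le_lt_trans lt; rewrite /phi (bigD1 i)//= lerDl.
    by apply: sumr_ge0 => j _; exact: sqr_ge0.
  have : g c i < e by rewrite -(ltr_pXn2r (n := 2))// ?nnegrE// ltW.
  have : a - c i <= g c i by rewrite le_max lexx.
  by lra.
apply: contrapT => /eqP Mn0; have {}M0 : 0 < M by rewrite lt_neqAle eq_sym Mn0.
pose m : R := #|I|%:R.
have m1 : 1 <= m by rewrite ler1n; apply/card_gt0P; exists i0.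
pose K := m * (`|a| + 1).
have K0 : 0 <= K by rewrite mulr_ge0// ?addr_ge0//; lra.
(* With this step length the quadratic term [s ^+ 2 * m] is at most [s * M / 2], while the linear
   gain is at least [s * M]. The net gain [s * M / 2] beats the slack [s * M / 4] allowed to the
   almost minimizer. *)
pose s := Num.min 1 (M / (2 * m)).
have s0 : 0 < s by rewrite lt_min ltr01 divr_gt0//; lra.
have s1 : s <= 1 by rewrite ge_min lexx.
have sm : s * m <= M / 2.
  apply: (@le_trans _ _ (M / (2 * m) * m)).
    by apply: ler_wpM2r; [lra|rewrite ge_min lexx orbT].
  by rewrite le_eqVlt; apply/orP; left; apply/eqP; field; lra.
have [|_ [c Cc <-] hc] := @inf_adherent _ _ (s * M / 4) _ hi.
  by rewrite divr_gt0// mulr_gt0.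
rewrite -/M in hc.
pose G := \sum_i g c i.
have gK i : g c i <= `|a| + 1.
  rewrite ge_max; apply/andP; split; last by rewrite addr_ge0.
  by have := ler_norm a; have /andP[] := C01 c i Cc; lra.
have GK : G <= K.
  rewrite /K /m mulr_natl -sumr_const; apply: ler_sum => i _; exact: gK.
have G0 : 0 < G.
  rewrite lt_neqAle sumr_ge0// andbT eq_sym; apply/eqP => /eqP.
  rewrite psumr_eq0// => /allP gz; suff : phi c = 0 by have := Mle _ Cc; lra.
  by rewrite /phi big1// => i _; rewrite (eqP (gz i _)) ?expr0n// mem_index_enum.
(* The precision of the response, such that its effect [G * kap] is at most [M / 2]. *)
pose kap := M / (2 * (K + 1)).
have kap0 : 0 < kap by rewrite divr_gt0//; lra.
have [||c' Cc' hc'] := Cq (fun i => g c i / G) _ _ kap kap0.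
- by move=> i; rewrite divr_ge0// ltW.
- by rewrite -mulr_suml divff// gt_eqF.
have hG : G * (a - kap) <= \sum_i g c i * c' i.
  rewrite -ler_pdivlMl// mulrC mulr_suml.
  by under eq_bigr do rewrite mulrAC.
(* [g c i] vanishes unless [c i < a], so [g c i * (a - c i)] is always its square. *)
have hself : \sum_i g c i * c i = a * G - phi c.
  rewrite /G mulr_sumr /phi -sumrB; apply: eq_bigr => i _.
  by rewrite /g; case: (leP (a - c i) 0) => h; rewrite ?expr2; ring.
have Gkap : G * kap <= M / 2.
  apply: (@le_trans _ _ ((K + 1) * kap)); first by rewrite ler_pM2r//; lra.
  by rewrite /kap le_eqVlt; apply/orP; left; apply/eqP; field; lra.
pose c2 i := (1 - s) * c i + s * c' i.
have Cc2 : C c2 by apply: Cconv => //; lra.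
have phi2 : phi c2 <= phi c - 2 * s * (\sum_i g c i * c' i - \sum_i g c i * c i) + s ^+ 2 * m.
  have -> : phi c - 2 * s * (\sum_i g c i * c' i - \sum_i g c i * c i) + s ^+ 2 * m =
      \sum_i (g c i ^+ 2 - 2 * s * (g c i * c' i - g c i * c i) + s ^+ 2).
    by rewrite big_split/= sumrB -mulr_sumr sumrB sumr_const /m mulr_natr.
  apply: ler_sum => i _.
  have /andP[? ?] := C01 c i Cc; have /andP[? ?] := C01 c' i Cc'.
  apply: (@le_trans _ _ ((g c i - s * (c' i - c i)) ^+ 2)).
    have h : a - c2 i <= g c i - s * (c' i - c i).
      have : a - c i <= g c i by rewrite le_max lexx.
      by rewrite /c2; lra.
    rewrite {1}/g; case: (leP (a - c2 i) 0) => h0.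
      by rewrite expr0n/= sqr_ge0.
    by rewrite ler_pXn2r// ?nnegrE//; lra.
  have : (c' i - c i) ^+ 2 <= 1 by rewrite expr2; nra.
  move=> h2; have : s ^+ 2 * (c' i - c i) ^+ 2 <= s ^+ 2 by rewrite ler_piMr// sqr_ge0.
  by lra.
have := Mle _ Cc2; have h1 := Mle _ Cc.
have h3 : s ^+ 2 * m <= s * (M / 2) by rewrite expr2 -mulrA ler_pM2l.
have h4 : M / 2 <= \sum_i g c i * c' i - \sum_i g c i * c i by rewrite hself; lra.
have h5 : 2 * s * (phi c - M / 2) <= 2 * s * (\sum_i g c i * c' i - \sum_i g c i * c i).
  by rewrite ler_pM2l ?mulr_gt0//; rewrite hself; lra.
have h6 : s * M <= 2 * s * (phi c - M / 2).
  have -> : s * M = 2 * s * (M / 2) by field.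
  by rewrite ler_pM2l ?mulr_gt0//; lra.
have : 0 < s * M by rewrite mulr_gt0.
by lra.
Qed.

End Minmax.

(** * Weightings that are constant on blocks *)

Section Blocks.
Context {R : realType}.
Implicit Types (th p : nat -> R).

Lemma sum_blocks (f : nat -> R) K N :
  \sum_(t < K * N) f t = \sum_(k < K) \sum_(i < N) f (k * N + i)%N.
Proof.
elim: K => [|K IH]; first by rewrite mul0n !big_ord0.
by rewrite mulSnr big_split_ord/= IH big_ord_recr.
Qed.

Definition blk (N : nat) p t : R := p (t %/ N)%N / N%:R.

Lemma blkE N p k i : (i < N)%N -> blk N p (k * N + i)%N = p k / N%:R.
Proof.
move=> iN; have N0 : (0 < N)%N by exact: leq_ltn_trans iN.
by rewrite /blk divnMDl// divn_small// addn0.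
Qed.

Lemma blk_feval N p K : (0 < N)%N -> is_feval p K -> is_feval (blk N p) (K * N).
Proof.
move=> N0 [p0 tl p1]; split.
- by move=> t; rewrite /blk divr_ge0.
- by move=> t; rewrite -leq_divRL// => /tl h; rewrite /blk h mul0r.
- rewrite sum_blocks -[RHS]p1; apply: eq_bigr => k _.
  under eq_bigr do rewrite blkE//.
  rewrite sumr_const card_ord -[_ *+ _]mulr_natl mulrCA divff ?mulr1// pnatr_eq0.
  by rewrite -lt0n.
Qed.

(** The weights change only between blocks, by at most [(p k.+1 + p k) / N], and [p] has mass 1. The
    bound is the same for all [p]. *)
Lemma blk_impatience N p K : (0 < N)%N -> is_feval p K ->
  (impatience (blk N p) <= (2 / N%:R)%:E)%E.
Proof.
move=> N0 fe; have [p0 _ _] := fe; apply: variation_le_impatience => m.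
apply: (@le_trans _ _ (\sum_(t < m * N) `|blk N p t.+1 - blk N p t|)).
  have mN : (m <= m * N)%N by rewrite leq_pmulr.
  by rewrite -(subnKC mN) [leRHS]big_split_ord/= lerDl sumr_ge0.
rewrite (sum_blocks (fun t => `|blk N p t.+1 - blk N p t|)).
apply: (@le_trans _ _ (\sum_(k < m) (p k.+1 + p k) / N%:R)).
  apply: ler_sum => k _; case: N N0 => // N _.
  rewrite big_ord_recr/= big1 ?add0r => [|i _]; last first.
    by rewrite -addnS !blkE ?subrr ?normr0// !ltnS// ltnW.
  have -> : (k * N.+1 + N).+1 = (k.+1 * N.+1 + 0)%N by rewrite mulSnr addn0 addnS.
  rewrite !blkE// -mulrBl normrM [`|N.+1%:R^-1|]ger0_norm// ler_wpM2r//.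
  by apply: le_trans (ler_normB _ _) _; rewrite !ger0_norm.
rewrite -mulr_suml ler_pM2r ?invr_gt0 ?ltr0n// big_split/=.
have h1 := eval_partial m (feval_is_eval fe).
have := eval_partial m.+1 (feval_is_eval fe); rewrite big_ord_recl/=.
rewrite -[X in _ + X <= _]/(\sum_(i < m) p i.+1).
by have := p0 0%N; lra.
Qed.

(** On block [k] the weights stay within the variation [V k] of their first value. For constant
    weights the block average gives the bound; the correction costs at most [2 * V k] per stage, as
    [a - rho] has absolute value at most 2. *)
Lemma block_weights_lower th (rho : nat -> R) (a b : R) N : (0 < N)%N -> is_eval th ->
  (impatience th <= b%:E)%E -> (forall t, 0 <= rho t <= 1) -> -1 <= a <= 1 ->
  (forall k, N%:R * a <= \sum_(i < N) rho (k * N + i)%N) ->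
  forall K, a * \sum_(t < K * N) th t - 2 * N%:R * b <= \sum_(t < K * N) th t * rho t.
Proof.
move=> N0 ev imp rho01 a1 hb K; have th0 : forall t, 0 <= th t by case: ev.
pose V k := \sum_(j < N) `|th (k * N + j).+1 - th (k * N + j)%N|.
have NV : \sum_(k < K) V k <= b.
  by rewrite -(sum_blocks (fun t => `|th t.+1 - th t|)); exact: impatience_partial.
have thV k i : (i < N)%N -> `|th (k * N + i)%N - th (k * N)%N| <= V k.
  move=> iN; apply: (@le_trans _ _ (\sum_(j < i) `|th (k * N + j).+1 - th (k * N + j)%N|)).
    elim: i {iN} => [|i IH]; first by rewrite addn0 subrr normr0 big_ord0.
    rewrite big_ord_recr/= addnS addrC.
    have -> : th (k * N + i).+1 - th (k * N)%N =
      (th (k * N + i).+1 - th (k * N + i)%N) + (th (k * N + i)%N - th (k * N)%N) by ring.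
    by apply: le_trans (ler_normD _ _) _; rewrite lerD2l.
  by rewrite /V -(subnKC (ltnW iN)) [leRHS]big_split_ord/= lerDl sumr_ge0.
have blockk k : a * (\sum_(i < N) th (k * N + i)%N) - 2 * N%:R * V k <=
    \sum_(i < N) th (k * N + i)%N * rho (k * N + i)%N.
  rewrite lerBlDr -lerBlDl.
  have -> : a * (\sum_(i < N) th (k * N + i)%N) -
      \sum_(i < N) th (k * N + i)%N * rho (k * N + i)%N =
      \sum_(i < N) (th (k * N + i)%N - th (k * N)%N) * (a - rho (k * N + i)%N) +
      th (k * N)%N * (N%:R * a - \sum_(i < N) rho (k * N + i)%N).
    rewrite mulrBr [N%:R * a]mulr_natl -[N in a *+ N]card_ord -sumr_const.
    rewrite !mulr_sumr -!sumrB -big_split/=.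
    by apply: eq_bigr => i _; ring.
  rewrite -[leRHS]addr0; apply: lerD; last first.
    by rewrite mulr_ge0_le0// subr_le0.
  apply: le_trans (ler_norm _) _; apply: le_trans (ler_norm_sum _ _ _) _.
  have -> : 2 * N%:R * V k = \sum_(i < N) V k * 2.
    by rewrite sumr_const card_ord -[_ *+ _]mulr_natl; ring.
  apply: ler_sum => i _; rewrite normrM; apply: ler_pM => //; first exact: thV.
  by have := rho01 (k * N + i)%N; rewrite ler_norml; lra.
rewrite (sum_blocks th) (sum_blocks (fun t => th t * rho t)) mulr_sumr.
apply: (@le_trans _ _ (\sum_(k < K)
    (a * (\sum_(i < N) th (k * N + i)%N) - 2 * N%:R * V k))); last first.
  exact: ler_sum.
by rewrite sumrB; apply: lerB => //; rewrite -mulr_sumr; apply: ler_wpM2l => //; rewrite mulr_ge0.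
Qed.

End Blocks.

(** * Construction of uniform plays and conclusion *)

Section UniformValue.
Context {R : realType} {X : pointedType}.
Variables (d : X -> X -> R) (F : X -> set (X -> R)) (r : X -> R).
Hypothesis dm : is_metric d.
Hypothesis dc : dcompact d.
Hypothesis F0 : forall x, exists u, F x u.
Hypothesis Fp : forall x u, F x u -> is_fsprob u.
Hypothesis r01 : forall x, 0 <= r x <= 1.
Hypothesis cr : dcontinuous d r.
Hypothesis Fne : forall x x' u, F x u -> exists2 u', F x' u' & dKR_fs d u u' <= d x x'.
Implicit Types (th p : nat -> R) (u : X -> R).

Local Notation bellman := (bellman F r).
Local Notation fpath := (fpath F).

Lemma fpath_convex u us us' (s : R) : is_fsprob u -> fpath u us -> fpath u us' ->
  0 <= s <= 1 -> exists2 vs, fpath u vs & forall t f,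
    integ_fs (vs t) f = (1 - s) * integ_fs (us t) f + s * integ_fs (us' t) f.
Proof.
move=> pu pus pus' /andP[s0 s1].
have fus := fpath_fsprob Fp pu pus; have fus' := fpath_fsprob Fp pu pus'.
pose lam (b : bool) := if b then 1 - s else s.
pose w t (b : bool) := if b then us t else us' t.
have lam0 b : 0 <= lam b by case: b => //=; rewrite subr_ge0.
have pw t b : is_fsprob (w t b) by rewrite /w; case: b; [exact: fus|exact: fus'].
exists (fun t => mixt lam (w t)).
  split.
    apply/funext => y; rewrite /mixt big_bool /= (pus.1) (pus'.1).
    by ring.
  move=> t; apply: (Fhat_mixt F0) => // b.
  by case: b; [case: pus => _ h|case: pus' => _ h]; exact: h.
move=> t f; rewrite integ_fs_mixt; last by move=> b; case: (pw t b).
by rewrite big_bool.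
Qed.

Section FixedBlock.
Variable N : nat.
Hypothesis N0 : (0 < N)%N.

Definition blkval p K : X -> R := bellman (blk N p) (K * N).

(** The invariant of the block construction: one bound for all block weightings at once, of every
    length. *)
Definition guarantees u (c : R) :=
  forall p K, is_feval p K -> c <= integ_fs u (blkval p K).

Definition blkavg (us : nat -> X -> R) : R :=
  N%:R^-1 * \sum_(i < N) integ_fs (us i.+1) r.

Lemma blkval01 p K x : is_feval p K -> 0 <= blkval p K x <= 1.
Proof.
move=> fe; have [b0 _ b1] := blk_feval N0 fe.
by have := bellman_bound F0 Fp r01 (K * N) x b0; rewrite b1.
Qed.

(* One block: by minmax, a single path has a good average on the block and
   keeps the value of finitely many, hence of all, block weightings. *)
Lemma guarantees_step u c e : is_fsprob u -> guarantees u c -> 0 < e ->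
  exists us, [/\ fpath u us, c - e <= blkavg us & guarantees (us N) (c - e)].
Proof.
move=> pu gu e0; have e2 : 0 < e / 2 by rewrite divr_gt0.
pose J := {pk : (nat -> R) * nat | is_feval pk.1 pk.2}.
pose h (j : J) := blkval (projT1 j).1 (projT1 j).2.
have eh : equicont d h.
  move=> e' e'0; have [a a0 ha] := bellman_equicont dm dc F0 Fp Fne r01 cr e'0.
  exists a => // j x y xy; have [b0 _ b1] := blk_feval N0 (projT2 j).
  by apply: ha => //; rewrite b1.
have h01 j x : 0 <= h j x <= 1 by apply: blkval01; exact: (projT2 j).
have [m [j hj]] := equicont_totally_bounded dm dc eh h01 e2.
(* Coordinate [ord0] is the average on the current block; the others are the continuation values of
   the finite family. *)
pose val us (i : 'I_m.+1) : R :=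
  if unlift ord0 i is Some k then integ_fs (us N) (h (j k)) else blkavg us.
pose C : set ('I_m.+1 -> R) := [set c | exists2 us, fpath u us & c = val us].
have N0R : 0 < N%:R :> R by rewrite ltr0n.
have [|||_ [us pus ->] hus] := @convex_minmax _ _ C c ord0 _ _ _ _ e2.
- move=> _ _ s [us pus ->] [us' pus' ->] s01.
  have [vs pvs hvs] := fpath_convex pu pus pus' s01; exists vs => //.
  apply/esym/funext => i /=; rewrite /val; case: unliftP => [k _|_]; first by rewrite hvs.
  rewrite /blkavg [X in _ = X + _]mulrCA [X in _ = _ + X]mulrCA -mulrDr; congr (_ * _).
  rewrite !mulr_sumr -big_split/=; apply: eq_bigr => k _.
  by rewrite hvs.
- move=> _ i [us pus ->]; have pt := fpath_fsprob Fp pu pus.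
  rewrite /val; case: unliftP => [k _|_]; first exact: integ_fs_bound.
  have s01 k : 0 <= integ_fs (us k) r <= 1 by exact: integ_fs_bound.
  rewrite /blkavg mulr_ge0 ?invr_ge0 ?sumr_ge0//=; last by move=> k _; have /andP[] := s01 k.+1.
  rewrite ler_pdivrMl// mulr1 -[leRHS]mulr1 mulr_natl -[N in _ *+ N]card_ord -sumr_const.
  by apply: ler_sum => k _; have /andP[] := s01 k.+1.
- move=> q q0 q1 e' e'0.
  pose P k := (projT1 (j k)).1; pose D k := (projT1 (j k)).2.
  have fe k : is_feval (P k) (D k) by exact: (projT2 (j k)).
  pose L := (\max_k D k)%N.
  have DL k : (D k <= L)%N by exact: leq_bigmax.
  (* The weights [q] read as a block weighting: mass [q ord0] on the current block, then the mixture
     of the chosen weightings delayed by one block. By [gu] its value is at least [c]. *)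
  pose p t := if t is t'.+1 then \sum_k q (lift ord0 k) * P k t' else q ord0.
  have pfe : is_feval p L.+1.
    split.
    + by case=> [|t]; rewrite /p// sumr_ge0// => k _; rewrite mulr_ge0//; case: (fe k).
    + case=> [//|t]; rewrite ltnS => Lt; rewrite /p big1// => k _.
      by have [_ tl _] := fe k; rewrite tl ?mulr0// (leq_trans (DL k)).
    + rewrite big_ord_recl/= exchange_big/= -[RHS]q1 [RHS]big_ord_recl; congr (_ + _).
      apply: eq_bigr => k _; rewrite -mulr_sumr -[RHS]mulr1; congr (_ * _).
      have [_ tl <-] := fe k; rewrite -(subnKC (DL k)) big_split_ord/=.
      by rewrite [X in _ + X]big1 ?addr0// => i _; rewrite tl// leq_addr.
  have [us pus hus] := bellman_near_opt F0 Fp r01 (blk N p) N (L * N) pu e'0.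
  exists (val us); first by exists us.
  have pt := fpath_fsprob Fp pu pus.
  apply: le_trans (_ : _ <= integ_fs u (blkval p L.+1) - e') _.
    by rewrite lerD2r; exact: gu.
  rewrite /blkval mulSn; apply: le_trans hus _.
  rewrite big_ord_recl; apply: lerD.
    rewrite {1}/val unlift_none /blkavg mulrA mulr_sumr; apply: ler_sum => i _.
    by have := blkE p 0 (ltn_ord i); rewrite mul0n add0n => ->.
  have -> : (fun t => blk N p (N + t)%N) =
      (fun t => \sum_k q (lift ord0 k) * blk N (P k) t).
    apply/funext => t; rewrite /blk divnDl// divnn N0 /= mulr_suml.
    by apply: eq_bigr => k _; rewrite mulrA.
  apply: (@le_trans _ _ (integ_fs (us N) (fun x =>
      \sum_k q (lift ord0 k) * bellman (blk N (P k)) (L * N) x))).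
    by apply: ler_integ_fs => // x; apply: bellman_convex.
  have [s cs] := fsprob_carries (pt N).
  rewrite (integ_fsE _ cs); under eq_bigr do rewrite mulr_sumr.
  rewrite exchange_big/=; apply: ler_sum => k _.
  rewrite /val liftK (integ_fsE _ cs) mulr_sumr; apply: ler_sum => x _.
  have [_ tl _] := blk_feval N0 (fe k).
  rewrite (bellman_zero_tail F0 Fp r01 x tl); last by rewrite leq_mul2r DL orbT.
  by rewrite mulrCA.
exists us; have pt := fpath_fsprob Fp pu pus; split => //.
  by have := hus ord0; rewrite /val unlift_none; lra.
move=> p K fe; have [k hk] := hj (exist _ (p, K) fe).
have := integ_fs_dist (pt N) hk; rewrite ler_norml => /andP[+ _].
by have := hus (lift ord0 k); rewrite /val liftK /h/=; lra.
Qed.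

Lemma guarantees_path u c e : is_fsprob u -> guarantees u c -> 0 < e ->
  exists2 us, fpath u us &
    forall k, N%:R * (c - e) <= \sum_(i < N) integ_fs (us (k * N + i).+1) r.
Proof.
move=> pu gu e0.
(* Block [k] may lose [e / 2 ^ k.+1], and these losses sum to [e]. *)
pose ck k := c - e * (1 - 2 ^- k).
pose ek k := e * 2 ^- k.+1.
have ckS k : ck k.+1 = ck k - ek k.
  by rewrite /ck /ek exprS invfM; field; rewrite expf_neq0.
have ek0 k : 0 < ek k by rewrite mulr_gt0// invr_gt0 exprn_gt0.
have ck_ge k : c - e <= ck k.
  by rewrite /ck lerD2l lerN2 ler_piMr ?(ltW e0)// lerBlDr lerDl invr_ge0 exprn_ge0.
(* Choice is made over all pairs of a block index and a state, with a dummy path where the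
   assumptions fail; the states actually reached are defined only afterwards, by [U]. *)
have /choice[sel hsel] : forall ku : nat * (X -> R), exists us,
    is_fsprob ku.2 -> guarantees ku.2 (ck ku.1) ->
    [/\ fpath ku.2 us, ck ku.1.+1 <= blkavg us & guarantees (us N) (ck ku.1.+1)].
  move=> [k v]; have [[pv gv]|n] := pselect (is_fsprob v /\ guarantees v (ck k)).
    by have [us h] := guarantees_step pv gv (ek0 k); exists us => _ _; rewrite ckS.
  by exists (fun=> v) => /= pv gv; exfalso; apply: n.
pose U := fix U k := if k is k'.+1 then sel (k', U k') N else u.
have UP k : is_fsprob (U k) /\ guarantees (U k) (ck k).
  elim: k => [|k [pk gk]].
    by split => //; rewrite /ck expr0 invr1 subrr mulr0 subr0.
  have [pa _ ga] := hsel (k, U k) pk gk.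
  by split => //; exact: (fpath_fsprob Fp pk pa).
have selP k := hsel (k, U k) (UP k).1 (UP k).2.
pose Us t := sel ((t %/ N)%N, U (t %/ N)%N) (t %% N)%N.
(* The case [i = N] is included: the end of block [k] is the start of block [k.+1], which glues the
   paths together. *)
have UsE k i : (i <= N)%N -> Us (k * N + i)%N = sel (k, U k) i.
  rewrite leq_eqVlt => /orP[/eqP ->|iN].
    rewrite -mulSnr /Us mulnK// modnMl.
    by have [[-> _] _ _] := selP k.+1.
  by rewrite /Us divnMDl// divn_small// addn0 modnMDl modn_small.
exists Us.
  split.
    by have := UsE 0%N 0%N (leq0n _); rewrite mul0n addn0 => ->; have [[-> _] _ _] := selP 0%N.
  move=> t; have tN : (t %% N < N)%N by rewrite ltn_mod.
  have E := UsE (t %/ N)%N _ (ltnW tN); have E' := UsE (t %/ N)%N _ tN.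
  rewrite -divn_eq in E; rewrite addnS -divn_eq in E'; rewrite E E'.
  by have [[_ h] _ _] := selP (t %/ N)%N; exact: h.
move=> k; have [_ h _] := selP k.
have N0R : 0 < N%:R :> R by rewrite ltr0n.
rewrite -ler_pdivlMl//; apply: le_trans (ck_ge k.+1) _.
apply: le_trans h _; rewrite /blkavg ler_pM2l ?invr_gt0//.
by apply: ler_sum => i _; rewrite -addnS UsE.
Qed.

End FixedBlock.

(** The restriction [e <= 1] keeps the target average in [[-1, 1]], as [block_weights_lower]
    requires. *)
Lemma vstar_uniform (e : R) : 0 < e -> e <= 1 -> exists2 a : R, 0 < a &
  exists sig : X -> nat -> X -> R, (forall x, is_play F x (sig x)) /\
    forall th, is_eval th -> (impatience th <= a%:E)%E ->
      forall x, vstar d F r x - e <= payoff r th (sig x).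
Proof.
move=> e0 e1; have e4 : 0 < e / 4 by rewrite divr_gt0.
have [a a0 ha] := bellman_lower dm dc F0 Fp r01 cr Fne e4.
(* A length above [2 / a] brings the impatience of every block weighting below the threshold of
   [bellman_lower]. *)
pose N := (Num.truncn (2 / a)).+1.
have N0 : (0 < N)%N by [].
have N0R : 0 < N%:R :> R by rewrite ltr0n.
have Na : 2 / N%:R <= a.
  by rewrite ler_pdivrMr// mulrC -ler_pdivrMr// ltW//; exact: truncnS_gt.
have gx x : guarantees N (dirac_fs x) (vstar d F r x - e / 4).
  move=> p K fe; rewrite integ_dirac_fs; apply: ha; first exact: blk_feval.
  by apply: le_trans (blk_impatience N0 fe) _; rewrite lee_fin.
have /choice[us hus] : forall x, exists us, fpath (dirac_fs x) us /\
    forall k, N%:R * (vstar d F r x - e / 4 - e / 4) <= \sum_(i < N) integ_fs (us (k * N + i).+1) r.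
  move=> x; have [us p h] := guarantees_path N0 (dirac_fsprob x) (gx x) e4.
  by exists us.
(* This cancels the factor [2 * N] of [block_weights_lower] and leaves [e / 4]. The other three
   quarters are the bound on block values, the losses over the blocks and the mass after stage
   [n * N]. *)
exists (e / 4 / (2 * N%:R)); first by rewrite divr_gt0// mulr_gt0.
exists (fun x t => us x t.+1); split.
  by move=> x; apply: (fpath_play F0); exact: (hus x).1.
move=> th ev imp x; have ps := fpath_play F0 (hus x).1.
have v0 := vstar_ge0 dm dc F0 Fp r01 cr Fne x; have v1 := vstar_le1 dm dc F0 Fp r01 cr Fne x.
have rho01 t : 0 <= rbar r (us x t.+1) <= 1.
  by apply: integ_fs_bound r01; exact: (play_fsprob Fp ps t).
have a1 : -1 <= vstar d F r x - e / 4 - e / 4 <= 1 by apply/andP; split; lra.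
have low := block_weights_lower N0 ev imp rho01 a1 (hus x).2.
have [n hn] := eval_tail ev e4.
have nN : (n <= n * N)%N by rewrite leq_pmulr.
have hn' : 1 - e / 4 < \sum_(t < n * N) th t.
  apply: lt_le_trans hn _; rewrite -(subnKC nN) [leRHS]big_split_ord/= lerDl sumr_ge0//.
  by move=> i _; case: ev.
have h1 := eval_partial (n * N) ev.
have /andP[h2 _] := payoff_bounds Fp r01 (n * N) ev ps.
apply: le_trans h2; apply: le_trans (low n).
have -> : 2 * N%:R * (e / 4 / (2 * N%:R)) = e / 4 by field; rewrite gt_eqF.
set S := \sum_(t < n * N) th t in hn' h1 *.
set A := vstar d F r x - e / 4 - e / 4 in a1 *.
have : A - e / 4 <= A * S by case/andP: a1 => ? ?; nra.
by rewrite /A; lra.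
Qed.

Lemma payoff_has_sup th x : is_eval th -> has_sup [set payoff r th s | s in is_play F x].
Proof.
move=> ev; split.
  have [us pus] := fpath_ex F0 (dirac_fs x).
  by exists (payoff r th (fun t => us t.+1)), (fun t => us t.+1) => //; exact: fpath_play.
exists 1 => _ [s ps <-]; have /andP[_] := payoff_bounds Fp r01 0 ev ps.
by rewrite !big_ord0 add0r subr0.
Qed.

Lemma vstar_general_limit_value : has_general_limit_value F r (vstar d F r).
Proof.
move=> e0' ep; pose e := Num.min e0' 1.
have e0 : 0 < e by rewrite lt_min ep ltr01.
have e1 : e <= 1 by rewrite ge_min lexx orbT.
have ee : e <= e0' by rewrite ge_min lexx.
have [a a0 [sig [psig hsig]]] := vstar_uniform e0 e1.
have [w adw wE] := vstar_admissible dm dc F0 Fp r01 cr Fne.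
have [b b0 hb] := admissible_upper dm dc F0 Fp r01 cr adw e0.
exists (Num.min a b); first by rewrite lt_min a0.
move=> th ev imp x; have hs := payoff_has_sup x ev.
have impa : (impatience th <= a%:E)%E.
  by apply: le_trans imp _; rewrite lee_fin ge_min lexx.
have impb : (impatience th <= b%:E)%E.
  by apply: le_trans imp _; rewrite lee_fin ge_min lexx orbT.
have up : vtheta F r th x <= vstar d F r x + e.
  apply: ge_sup; first exact: hs.1.
  by move=> _ [s ps <-]; rewrite -wE; exact: hb.
have lo : payoff r th (sig x) <= vtheta F r th x.
  by apply: ub_le_sup; [exact: hs.2|exists (sig x)].
by have := hsig th ev impa x; rewrite ler_norml; lra.
Qed.

End UniformValue.

Theorem theorem3 (R : realType) (X : pointedType) (d : X -> X -> R)
    (F : X -> set (X -> R)) (r : X -> R) :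
  is_metric d -> dcompact d ->
  (forall x, exists u, F x u) ->
  (forall x u, F x u -> is_fsprob u) ->
  (forall x, 0 <= r x <= 1) ->
  dcontinuous d r ->
  (forall x x' u, F x u -> exists2 u', F x' u' & dKR_fs d u u' <= d x x') ->
  has_general_uniform_value F r (vstar d F r).
Proof.
move=> dm dc F0 Fp r01 cr Fne; split; first exact: vstar_general_limit_value.
move=> e e0.
have [||a a0 [sig [ps h]]] := vstar_uniform dm dc F0 Fp r01 cr Fne (e := Num.min e 1).
- by rewrite lt_min e0 ltr01.
- by rewrite ge_min lexx orbT.
exists a => //; exists sig; split => // th ev imp x; apply: le_trans (h th ev imp x).
by rewrite lerD2l lerN2 ge_min lexx.
Qed.
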